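(* Let $k$ be an algebraically closed field of characteristic three. A partition of $12$ occurs as the configuration of singular fibres of a rational elliptic surface over $k$ all of whose singular fibres are multiplicative if and only if it is one of the following $40$ partitions (the remaining $37$ partitions of $12$ do not occur): $1^{12}$; $2\,1^{10}$; $3\,1^9$; $2^2\,1^8$; $4\,1^8$; $3\,2\,1^7$; $5\,1^7$; $2^3\,1^6$; $4\,2\,1^6$; $3^2\,1^6$; $6\,1^6$; $3\,2^2\,1^5$; $5\,2\,1^5$; $4\,3\,1^5$; $7\,1^5$; $2^4\,1^4$; $4\,2^2\,1^4$; $3^2\,2\,1^4$; $6\,2\,1^4$; $5\,3\,1^4$; $4^2\,1^4$; $8\,1^4$; $3\,2^3\,1^3$; $5\,2^2\,1^3$; $4\,3\,2\,1^3$; $7\,2\,1^3$; $5\,4\,1^3$; $2^5\,1^2$; $4\,2^3\,1^2$; $3^2\,2^2\,1^2$; $6\,2^2\,1^2$; $5\,3\,2\,1^2$; $4^2\,2\,1^2$; $8\,2\,1^2$; $5^2\,1^2$; $3\,2^4\,1$; $4\,3\,2^2\,1$; $2^6$; $4\,2^4$; $4^2\,2^2$. Moreover, each of these $40$ partitions occurs on such a surface for which $b_2$ has distinct roots.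
   Context: A rational elliptic surface $f:X\to\mathbb{P}^1$ over $k$ is assumed relatively minimal and with a section. It is given by a (minimal) Weierstrass equation $y^2=x^3+b_2x^2-b_4x+b_6$ with $b_i\in k[t]$, $\deg b_i\le i$, and discriminant $\Delta=-b_2^2(b_2b_6-b_4^2)+b_4^3$. The $b_i$ are regarded as sections of $\mathcal{O}_{\mathbb{P}^1}(i)$, so $b_2\neq0$ has two roots on $\mathbb{P}^1$ (possibly at $\infty$) counted with multiplicity, and $\Delta$ has $12$ zeros counted with multiplicity. A singular fibre is multiplicative if $\Delta$ vanishes there and $b_2$ does not; it is then of Kodaira type $\mathrm{I}_n$, with $n$ the order of vanishing of $\Delta$. When all singular fibres are multiplicative, of types $\mathrm{I}_{n_1},\mathrm{I}_{n_2},\dots$, the configuration is the partition $n_1\,n_2\cdots$ of $12$, with repeated terms written as exponents: for instance $5\,3^2\,1$ denotes $\mathrm{I}_5\,\mathrm{I}_3\,\mathrm{I}_3\,\mathrm{I}_1$. *)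

(* Defs.v *)
From mathcomp Require Import all_boot all_order all_algebra.

Set Implicit Arguments.
Unset Strict Implicit.
Unset Printing Implicit Defensive.

Import GRing.Theory.
Local Open Scope ring_scope.

(* Points of P^1 over a field k: [Some a] is the point t = a, and [None] is the
   point t = oo. *)
Definition P1 (k : fieldType) := option k.

(* A section of O(n) on P^1 is given by p : {poly k} of degree at most n. In the
   coordinate s = 1/t at oo it becomes s^n p(1/s). *)
Definition in_chart (k : fieldType) (n : nat) (p : {poly k}) (P : P1 k) :
    {poly k} :=
  if P is Some _ then p else \poly_(i < n.+1) p`_(n - i).

Definition coordinate (k : fieldType) (P : P1 k) : k :=
  if P is Some a then a else 0.

Definition uniformizer (k : fieldType) (P : P1 k) : {poly k} :=
  'X - (coordinate P)%:P.

Definition vanishes (k : fieldType) (n : nat) (p : {poly k}) (P : P1 k) : bool :=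
  root (in_chart n p P) (coordinate P).

(* Only meaningful for p != 0. *)
Definition vanishing_order (k : fieldType) (n : nat) (p : {poly k}) (P : P1 k) :
    nat :=
  mup (coordinate P) (in_chart n p P).

(* The discriminant of y^2 = x^3 + b2 x^2 - b4 x + b6 in characteristic 3. *)
Definition discriminant (k : fieldType) (b2 b4 b6 : {poly k}) : {poly k} :=
  - b2 ^+ 2 * (b2 * b6 - b4 ^+ 2) + b4 ^+ 3.

(* In characteristic 3, x = x' + r turns (b2, b4, b6) into
   (b2, b4 + b2 r, r^3 + b2 r^2 - b4 r + b6). Since 2 is invertible, these
   substitutions and the scalings (x, y) = (u^2 x', u^3 y') are the only
   admissible changes of coordinates, so the equation fails to be minimal at P
   iff, with pi a uniformizer at P, some r integral at P makes the new b_i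
   divisible by pi^i for i = 2, 4, 6. This depends only on r mod pi^2, so r may
   be taken to be a polynomial in the coordinate at P. *)
Definition minimal_at (k : fieldType) (b2 b4 b6 : {poly k}) (P : P1 k) : Prop :=
  let c2 := in_chart 2 b2 P in
  let c4 := in_chart 4 b4 P in
  let c6 := in_chart 6 b6 P in
  let pi := uniformizer P in
  ~ exists r : {poly k},
      [/\ pi ^+ 2 %| c2,
          pi ^+ 4 %| c4 + c2 * r
        & pi ^+ 6 %| r ^+ 3 + c2 * r ^+ 2 - c4 * r + c6].

(* A relatively minimal rational elliptic surface with section over P^1, in
   characteristic 3, presented by a globally minimal Weierstrass equation
   y^2 = x^3 + b2 x^2 - b4 x + b6 with b_i a section of O(i). *)
Record rational_elliptic_surface (k : closedFieldType) := RationalEllipticSurface {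
  b2 : {poly k};
  b4 : {poly k};
  b6 : {poly k};
  deg_b2 : (size b2 <= 3)%N;
  deg_b4 : (size b4 <= 5)%N;
  deg_b6 : (size b6 <= 7)%N;
  discriminant_neq0 : discriminant b2 b4 b6 != 0;
  weierstrass_minimal : forall P : P1 k, minimal_at b2 b4 b6 P
}.

Definition surface_discriminant (k : closedFieldType)
    (X : rational_elliptic_surface k) : {poly k} :=
  discriminant (b2 X) (b4 X) (b6 X).

Definition singular_fibre (k : closedFieldType)
    (X : rational_elliptic_surface k) (P : P1 k) : bool :=
  vanishes 12 (surface_discriminant X) P.

Definition multiplicative_fibre (k : closedFieldType)
    (X : rational_elliptic_surface k) (P : P1 k) : bool :=
  singular_fibre X P && ~~ vanishes 2 (b2 X) P.

Definition all_multiplicative (k : closedFieldType)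
    (X : rational_elliptic_surface k) : Prop :=
  forall P : P1 k, singular_fibre X P -> multiplicative_fibre X P.

(* The n such that a multiplicative fibre at P is of Kodaira type I_n. *)
Definition fibre_index (k : closedFieldType)
    (X : rational_elliptic_surface k) (P : P1 k) : nat :=
  vanishing_order 12 (surface_discriminant X) P.

(* X has singular fibres I_{s_1}, I_{s_2}, ..., all of them multiplicative. *)
Definition has_configuration (k : closedFieldType)
    (X : rational_elliptic_surface k) (s : seq nat) : Prop :=
  all_multiplicative X /\
  exists ps : seq (P1 k),
    [/\ uniq ps,
        forall P : P1 k, (P \in ps) = singular_fibre X P
      & perm_eq s [seq fibre_index X P | P <- ps]].

Definition b2_distinct_roots (k : closedFieldType)
    (X : rational_elliptic_surface k) : Prop :=
  b2 X != 0 /\ forall P : P1 k, (vanishing_order 2 (b2 X) P <= 1)%N.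

Definition is_partition (n : nat) (s : seq nat) : bool :=
  [&& sorted geq s, 0%N \notin s & sumn s == n].

(* [:: (n_1, e_1); (n_2, e_2); ...] stands for the partition
   n_1^{e_1} n_2^{e_2} ... *)
Definition multiplicative_configurations : seq (seq nat) :=
  [seq tally_seq bs | bs <- [::
    [:: (1, 12)];
    [:: (2, 1); (1, 10)];
    [:: (3, 1); (1, 9)];
    [:: (2, 2); (1, 8)];
    [:: (4, 1); (1, 8)];
    [:: (3, 1); (2, 1); (1, 7)];
    [:: (5, 1); (1, 7)];
    [:: (2, 3); (1, 6)];
    [:: (4, 1); (2, 1); (1, 6)];
    [:: (3, 2); (1, 6)];
    [:: (6, 1); (1, 6)];
    [:: (3, 1); (2, 2); (1, 5)];
    [:: (5, 1); (2, 1); (1, 5)];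
    [:: (4, 1); (3, 1); (1, 5)];
    [:: (7, 1); (1, 5)];
    [:: (2, 4); (1, 4)];
    [:: (4, 1); (2, 2); (1, 4)];
    [:: (3, 2); (2, 1); (1, 4)];
    [:: (6, 1); (2, 1); (1, 4)];
    [:: (5, 1); (3, 1); (1, 4)];
    [:: (4, 2); (1, 4)];
    [:: (8, 1); (1, 4)];
    [:: (3, 1); (2, 3); (1, 3)];
    [:: (5, 1); (2, 2); (1, 3)];
    [:: (4, 1); (3, 1); (2, 1); (1, 3)];
    [:: (7, 1); (2, 1); (1, 3)];
    [:: (5, 1); (4, 1); (1, 3)];
    [:: (2, 5); (1, 2)];
    [:: (4, 1); (2, 3); (1, 2)];
    [:: (3, 2); (2, 2); (1, 2)];
    [:: (6, 1); (2, 2); (1, 2)];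
    [:: (5, 1); (3, 1); (2, 1); (1, 2)];
    [:: (4, 2); (2, 1); (1, 2)];
    [:: (8, 1); (2, 1); (1, 2)];
    [:: (5, 2); (1, 2)];
    [:: (3, 1); (2, 4); (1, 1)];
    [:: (4, 1); (3, 1); (2, 2); (1, 1)];
    [:: (2, 6)];
    [:: (4, 1); (2, 4)];
    [:: (4, 2); (2, 2)]]]%N.

(* Main.v *)
Require Import Defs.
From mathcomp Require Import all_boot all_order all_algebra.
From mathcomp Require Import separable ring zify.
Import GRing.Theory.
Local Open Scope ring_scope.

Set Implicit Arguments.
Unset Strict Implicit.
Unset Printing Implicit Defensive.

(** All singular fibres being multiplicative means that [b2] and the
    discriminant [D] have no common zero on P^1. Suppose first that [b2] has two
    distinct roots, and move them to 0 and oo, so that [b2 = e X]. Then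
      [D = b4^3 + e^2 X^2 b4^2 - e^3 X^3 b6],
    where [b4^3] only has monomials of degree divisible by 3. The coefficients of
    degrees 3 to 9 can be prescribed through [b6], [D_0] and [D_12] are nonzero,
    and what is left is
      [D_1 = D_11 = 0] and [D_2^3 D_12^2 = D_10^3 D_0^2 <> 0]
    ([two_root_discriminant_of], [two_root_discriminant_realized]). So the
    partitions obtained in this way are those of the multiplicities of the
    polynomials of degree 12 with these properties. If [b2] has a double root,
    moving it to oo makes [b2] constant and gives similar necessary conditions on
    the coefficients of high degree ([double_root_discriminant_of]).

    Exclusion. Let [D] be the product of the [(X - a)^n] and let [S] be the
    product of the [X - a] over the roots whose multiplicity [n] is prime to 3.
    In characteristic 3, [D] divides [D' S] ([dvd_deriv_mult_prod]). The conditions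
    above make the degree of [D'] small: [D' / X] has degree at most 8 in the
    first case, and [D'] has degree at most 7 in the second one. Hence at least 4,
    respectively 5, of the multiplicities are prime to 3. This removes 34 of the
    37 partitions. For the partitions 7 2^2 1, 5 4 2 1 and 5 2^3 1, the first
    case is written in terms of the power sums of the roots with exponents 1, -1,
    2, -2, in which a multiplicity matters modulo 3 only, and of the product of
    the roots, where it matters fully; these equations have no solution
    ([no_two_root_7221], [no_two_root_5421], [no_two_root_52221]). In the second
    case only 5 2^3 1 has enough parts prime to 3, and a direct computation
    excludes it ([no_double_root_52221]).

    Existence. For each of the 40 partitions there is a polynomial [D] with the
    required properties over the field with nine elements, given by its
    factorization in [factorizations]. Its properties are verified by
    computation, and the corresponding surfaces have [b2 = e X]. *)

(** * Discriminants when the roots of b2 are in standard position *)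

Section CharThree.
Variables (k : fieldType) (char_k : 3%N \in [pchar k]).
Implicit Types (p q D : {poly k}).

Lemma three_eq0 : 3%:R = 0 :> k.
Proof. exact: (pcharf0 char_k). Qed.

Lemma two_eqN1 : 2%:R = -1 :> k.
Proof. by rewrite -[2%:R]subr0 -three_eq0; ring. Qed.

Lemma cubeD (p q : {poly k}) : (p + q) ^+ 3 = p ^+ 3 + q ^+ 3.
Proof.
have -> : (p + q) ^+ 3 = p ^+ 3 + q ^+ 3 + 3%:R%:P * (p * q * (p + q)).
  by rewrite raddfMn /=; ring.
by rewrite three_eq0 polyC0 mul0r addr0.
Qed.

Lemma coef_cube p i :
  (p ^+ 3)`_i = if (3 %| i)%N then p`_(i %/ 3)%N ^+ 3 else 0.
Proof.
elim/poly_ind: p i => [|p c IHp] i.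
  by rewrite expr0n !coef0 expr0n if_same.
rewrite cubeD exprMn -rmorphXn coefD coefMXn coefC /=.
have [lt_i3 | le3i] := ltnP i 3.
  by case: i lt_i3 => [|[|[|[]]]] //= _; rewrite ?coefD ?coefMX ?coefC ?add0r ?addr0.
have -> : (i == 0)%N = false by case: i le3i.
rewrite addr0 IHp.
have [j ->] : exists j, i = (j + 3)%N by exists (i - 3)%N; rewrite subnK.
rewrite addnK dvdn_addl // divnDr // coefD coefMX coefC.
by rewrite divnn addn1 /= addr0.
Qed.

(** Characterizes the discriminants of degree 12 with nonzero constant term when
    [b2] is a nonzero multiple of [X], that is, when its roots are 0 and oo. The
    equations are those satisfied by [D_0 = a^3], [D_2 = e^2 a^2],
    [D_12 = c^3], [D_10 = e^2 c^2]. *)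
Definition two_root_discriminant D :=
  [/\ D`_0 != 0 /\ D`_12 != 0, D`_1 = 0 /\ D`_11 = 0, D`_2 != 0
    & D`_2 ^+ 3 * D`_12 ^+ 2 = D`_10 ^+ 3 * D`_0 ^+ 2].

(** Conditions satisfied by the discriminant when [b2] is a nonzero constant [e],
    that is, when it has a double root at oo: then [D_12 = c^3], [D_9 = d^3],
    [D_8 = e^2 c^2] and [D_7 = 2 e^2 c d]. *)
Definition double_root_discriminant D :=
  [/\ D`_12 != 0, D`_11 = 0 /\ D`_10 = 0, D`_8 != 0
    & D`_7 ^+ 3 * D`_12 = - (D`_9 * D`_8 ^+ 3)].

Lemma coef_sqr_low p : (p ^+ 2)`_0 = p`_0 ^+ 2.
Proof. by rewrite expr2 coef0M. Qed.

Lemma coef_sqr_top p : (size p <= 5)%N ->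
  (p ^+ 2)`_8 = p`_4 ^+ 2 /\ (p ^+ 2)`_7 = p`_3 * p`_4 *+ 2.
Proof.
move=> sz; have p0 i : p`_(i + 5) = 0.
  by rewrite nth_default // (leq_trans sz) ?leq_addl.
rewrite !expr2 !coefM !big_ord_recl !big_ord0 /=.
rewrite /bump /= !(p0 0, p0 1, p0 2, p0 3)%N.
by split; ring.
Qed.

Lemma coef_sqr_big p i : (size p <= 5)%N -> (p ^+ 2)`_(i + 9) = 0.
Proof.
move=> sz; rewrite nth_default // (leq_trans (size_poly_exp_leq _ _)) //.
by case: (size p) sz => [|n] /=; lia.
Qed.

Lemma two_root_discriminant_of (e : k) (c4 c6 : {poly k}) :
    (size c4 <= 5)%N -> (size c6 <= 7)%N ->
    let D := discriminant (e *: 'X) c4 c6 in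
  e != 0 -> D`_0 != 0 -> D`_12 != 0 -> two_root_discriminant D.
Proof.
move=> sz4 sz6 D nz_e.
have -> : D = c4 ^+ 3 + 'X^2 * (e ^+ 2 *: c4 ^+ 2) - 'X^3 * (e ^+ 3 *: c6).
  by rewrite /D /discriminant -!mul_polyC !rmorphXn /=; ring.
rewrite /two_root_discriminant !(coefD, coefN, coefXnM, coefZ, coef_cube) /=.
have c6_0 i : c6`_(i + 7) = 0.
  by rewrite nth_default // (leq_trans sz6) ?leq_addl.
rewrite !(c6_0 0, c6_0 1, c6_0 2, coef_sqr_big 0 sz4, coef_sqr_big 1 sz4)%N.
have [-> _] := coef_sqr_top sz4; rewrite coef_sqr_low.
rewrite !(mulr0, addr0, subr0, add0r, oppr0) => nz0 nz12.
have nz_c0 : c4`_0 != 0 by apply: contraNneq nz0 => ->; rewrite expr0n.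
split=> //; first by rewrite mulf_neq0 ?expf_neq0.
by ring.
Qed.

Lemma double_root_discriminant_of (e : k) (c4 c6 : {poly k}) :
    (size c4 <= 5)%N -> (size c6 <= 7)%N ->
    let D := discriminant e%:P c4 c6 in
  e != 0 -> D`_12 != 0 -> double_root_discriminant D.
Proof.
move=> sz4 sz6 D nz_e.
have -> : D = c4 ^+ 3 + e ^+ 2 *: c4 ^+ 2 - e ^+ 3 *: c6.
  by rewrite /D /discriminant -!mul_polyC !rmorphXn /=; ring.
rewrite /double_root_discriminant !(coefD, coefN, coefZ, coef_cube) /=.
have c6_0 i : c6`_(i + 7) = 0.
  by rewrite nth_default // (leq_trans sz6) ?leq_addl.
rewrite !(c6_0 0, c6_0 1, c6_0 2, c6_0 3, c6_0 4, c6_0 5)%N.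
rewrite !(coef_sqr_big 0 sz4, coef_sqr_big 1 sz4, coef_sqr_big 2 sz4, coef_sqr_big 3 sz4)%N.
have [-> ->] := coef_sqr_top sz4.
rewrite !(mulr0, addr0, subr0, add0r, oppr0) => nz12.
have nz_c4 : c4`_4 != 0 by apply: contraNneq nz12 => ->; rewrite expr0n.
split=> //; first by rewrite mulf_neq0 ?expf_neq0.
rewrite -[c4`_3 * _ *+ 2]mulr_natl two_eqN1; ring.
Qed.
End CharThree.

(** * Multiplicities prime to the characteristic *)

(** A root is paired with its multiplicity, so that [unzip2 rs] is the
    configuration. *)
Definition mult_prod (k : fieldType) (rs : seq (k * nat)) : {poly k} :=
  \prod_(x <- rs) ('X - x.1%:P) ^+ x.2.

Definition num_prime_to_3 (s : seq nat) : nat := count (fun n => ~~ (3 %| n)%N) s.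

Section MultProd.
Variable k : fieldType.
Implicit Types (rs : seq (k * nat)).

Lemma mult_prod_monic rs : mult_prod rs \is monic.
Proof. by apply: monic_prod => x _; rewrite monic_exp ?monicXsubC. Qed.

Lemma mult_prod_neq0 rs : mult_prod rs != 0.
Proof. exact: monic_neq0 (mult_prod_monic rs). Qed.

Lemma mult_prod_cons x rs :
  mult_prod (x :: rs) = ('X - x.1%:P) ^+ x.2 * mult_prod rs.
Proof. exact: big_cons. Qed.

Lemma size_mult_prod rs : size (mult_prod rs) = (sumn (unzip2 rs)).+1.
Proof.
elim: rs => [|x rs IHrs]; first by rewrite /mult_prod big_nil size_poly1.
rewrite mult_prod_cons size_monicM ?mult_prod_neq0 ?monic_exp ?monicXsubC //.
by rewrite size_exp_XsubC IHrs /=; lia.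
Qed.

End MultProd.

Section Bound.
Variables (k : fieldType) (char_k : 3%N \in [pchar k]).
Implicit Types (rs : seq (k * nat)) (D : {poly k}).

(** A factor [(X - a)^n] divides [D'] if 3 divides [n], since its derivative is
    zero; otherwise [(X - a)^(n-1)] divides [D'] and the product on the right
    supplies the missing factor. *)
Lemma dvd_deriv_mult_prod rs :
  mult_prod rs %|
    (mult_prod rs)^`() * \prod_(x <- rs | ~~ (3 %| x.2)%N) ('X - x.1%:P).
Proof.
elim: rs => [|[a n] rs IHrs]; first by rewrite /mult_prod big_nil dvd1p.
rewrite mult_prod_cons big_cons /=; set P := mult_prod rs in IHrs *.
set S := \prod_(_ <- _ | _) _ in IHrs *.
rewrite derivM deriv_exp derivXsubC mul1r.
have [/dvdnP[m ->]|] := boolP (3 %| n)%N; rewrite ?negbK /=.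
  rewrite mulrnA -[_ *+ 3]mulr_natl.
  have -> : 3%:R = 0 :> {poly k} by rewrite -polyC_natr three_eq0.
  by rewrite mul0r mul0r add0r -mulrA dvdp_mul2l // expf_neq0 ?polyXsubC_eq0.
case: n => [|n _]; first by [].
set Y := _ - _.
have -> : (Y ^+ n *+ n.+1 * P + Y ^+ n.+1 * P^`()) * (Y * S) =
          Y ^+ n.+1 * (P * (S *+ n.+1) + Y * (P^`() * S)).
  by rewrite exprS -[Y ^+ n *+ _]mulr_natl -[S *+ _]mulr_natl; ring.
rewrite dvdp_mul2l ?expf_neq0 ?polyXsubC_eq0 //.
by apply: dvdp_add; [exact: dvdp_mulr (dvdpp _) | exact: dvdp_mull].
Qed.

Lemma size_radical rs :
  size (\prod_(x <- rs | ~~ (3 %| x.2)%N) ('X - x.1%:P)) =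
  (num_prime_to_3 (unzip2 rs)).+1.
Proof. by rewrite -big_filter size_prod_XsubC size_filter /num_prime_to_3 count_map. Qed.

(** Since [D_1 = D_11 = 0] and 12 = 0 in [k], the derivative is [X E] with [E] of
    degree at most 8; it is nonzero because of [D_2], and [X] is prime to [D]. So
    [D], of degree 12, divides [E] times a product of linear factors. *)
Lemma two_root_discriminant_radical rs :
    sumn (unzip2 rs) = 12%N -> two_root_discriminant (mult_prod rs) ->
  (4 <= num_prime_to_3 (unzip2 rs))%N.
Proof.
move=> sum12 [[nz0 _] [z1 z11] nz2 _].
have := dvd_deriv_mult_prod rs; have := size_radical rs.
set S := \prod_(_ <- _ | _) _; have := size_mult_prod rs.
set D := mult_prod rs in nz0 z1 z11 nz2 *; rewrite sum12 => szD szS.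
have nzS : S != 0 by rewrite -size_poly_gt0 szS.
pose E : {poly k} := \poly_(i < 9) D^`()`_i.+1.
have coD i : D^`()`_i.+1 = E`_i.
  rewrite [in RHS]coef_poly; case: ltnP => // le9i; rewrite coef_deriv.
  move: le9i; rewrite leq_eqVlt => /orP[/eqP <- | lt9i]; first by rewrite z11 mul0rn.
  move: lt9i; rewrite leq_eqVlt => /orP[/eqP <- | lt10i].
    by rewrite -[12%N]/(3 * 4)%N mulrnA -[_ *+ 3]mulr_natl three_eq0 // mul0r mul0rn.
  by rewrite nth_default ?mul0rn // szD.
have -> : D^`() = E * 'X.
  by apply/polyP=> -[|i]; rewrite coefMX /= ?coD // coef_deriv z1 mul0rn.
have nzE : E != 0.
  apply: contraNneq nz2 => E0; have := coD 0%N; rewrite E0 coef0 coef_deriv.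
  by rewrite -mulr_natr two_eqN1 // mulrN1 => /eqP; rewrite oppr_eq0.
rewrite mulrAC Gauss_dvdpl; last first.
  by rewrite -[X in coprimep _ X]subr0 -polyC0 coprimep_XsubC /root horner_coef0.
move/(dvdp_leq (mulf_neq0 nzE nzS)); rewrite szD size_mul // szS.
have szE : (size E <= 9)%N by exact: size_poly.
move: szE; rewrite addnS /=; set c := num_prime_to_3 _; move: (size E) c => a b; lia.
Qed.

(** Here the coefficients of [D'] of degrees 8 and 11 vanish because 9 = 12 = 0
    in [k], and those of degrees 9 and 10 because [D_10 = D_11 = 0]. *)
Lemma double_root_discriminant_radical rs :
    sumn (unzip2 rs) = 12%N -> double_root_discriminant (mult_prod rs) ->
  (5 <= num_prime_to_3 (unzip2 rs))%N.
Proof.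
move=> sum12 [_ [z11 z10] nz8 _].
have := dvd_deriv_mult_prod rs; have := size_radical rs.
set S := \prod_(_ <- _ | _) _; have := size_mult_prod rs.
set D := mult_prod rs in z10 z11 nz8 *; rewrite sum12 => szD szS.
have nzS : S != 0 by rewrite -size_poly_gt0 szS.
have nzD' : D^`() != 0.
  apply: contraNneq nz8 => D'0; have := coef_deriv D 7; rewrite D'0 coef0.
  rewrite -[8%N]/(6 + 2)%N mulrnDr (mulrnA _ 3 2) -[_ *+ 3]mulr_natl three_eq0 //.
  by rewrite mul0r mul0rn add0r -mulr_natr two_eqN1 // mulrN1 => /eqP; rewrite eq_sym oppr_eq0.
have szD' : (size D^`() <= 8)%N.
  apply/leq_sizeP=> i le8i; rewrite coef_deriv.
  have three0 m : D`_i.+1 *+ (3 * m) = 0.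
    by rewrite mulrnA -[_ *+ 3]mulr_natl three_eq0 // mul0r mul0rn.
  have [lt11i|le_i11] := ltnP 11 i; first by rewrite nth_default ?mul0rn // szD.
  have : i \in iota 8 4 by rewrite mem_iota; lia.
  rewrite !inE => /or4P[] /eqP Ei.
  - by rewrite [X in _ *+ X.+1]Ei (three0 3%N).
  - by rewrite Ei z10 mul0rn.
  - by rewrite Ei z11 mul0rn.
  - by rewrite [X in _ *+ X.+1]Ei (three0 4%N).
move/(dvdp_leq (mulf_neq0 nzD' nzS)); rewrite szD size_mul // szS.
rewrite addnS /=; set c := num_prime_to_3 _; move: szD'; move: (size D^`()) c => a b; lia.
Qed.

End Bound.

(** * Power sums of the roots *)

Section PowerSums.
Variable k : fieldType.
Implicit Types (l : seq k) (rs : seq (k * nat)).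

Definition with_multiplicity rs : seq k :=
  flatten [seq nseq x.2 x.1 | x <- rs].

Definition power_sum rs (f : k -> k) : k := \sum_(x <- rs) f x.1 *+ x.2.

Lemma power_sumE rs f :
  \sum_(a <- with_multiplicity rs) f a = power_sum rs f.
Proof.
rewrite /power_sum big_flatten big_map; apply: eq_bigr => x _.
by rewrite big_nseq iter_addr_0.
Qed.

Lemma mult_prodE rs :
  mult_prod rs = \prod_(a <- with_multiplicity rs) ('X - a%:P).
Proof.
rewrite /mult_prod big_flatten big_map; apply: eq_bigr => x _.
by rewrite big_nseq iter_mulr_1.
Qed.

Lemma size_with_multiplicity rs :
  size (with_multiplicity rs) = sumn (unzip2 rs).
Proof.
by rewrite size_flatten /shape -map_comp; congr sumn; apply: eq_map => x /=; rewrite size_nseq.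
Qed.

(** Newton's identities for the elementary symmetric functions of the inverses
    of the roots. *)
Lemma coef_prod_XsubC_low l : 0 \notin l ->
  let D := \prod_(a <- l) ('X - a%:P) in
  D`_1 = - (D`_0 * \sum_(a <- l) a^-1) /\
  D`_2 *+ 2 = D`_0 * ((\sum_(a <- l) a^-1) ^+ 2 - \sum_(a <- l) a^-1 ^+ 2).
Proof.
elim: l => [_|a l IHl]; first by rewrite /= !big_nil !coef1 /=; split; ring.
rewrite inE negb_or eq_sym => /andP[nz_a /IHl]; rewrite /= !big_cons.
set D := \prod_(b <- l) _; move=> [D1 D2].
rewrite !mulrBl !coefB !coefXM !coefCM /= D1; split; first by field.
by rewrite mulrnBl -[(a * _) *+ 2]mulrnAr D2; field.
Qed.

(** Newton's identities. The factors [X] and [X^2] make the two coefficients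
    below the leading one meaningful for lists with fewer than two elements. *)
Lemma coef_prod_XsubC_top l :
  let D := \prod_(a <- l) ('X - a%:P) in
  ('X * D)`_(size l) = - \sum_(a <- l) a /\
  ('X^2 * D)`_(size l) *+ 2 = (\sum_(a <- l) a) ^+ 2 - \sum_(a <- l) a ^+ 2.
Proof.
elim: l => [|a l]; first by rewrite /= !big_nil !mulr1 coefX coefXn /=; split; ring.
rewrite /= !big_cons; set D := \prod_(b <- l) _; move=> [D1 D2].
have Dn : D`_(size l) = 1.
  have /monicP := monic_prod_XsubC l xpredT id.
  by rewrite /lead_coef size_prod_XsubC.
have -> : 'X * (('X - a%:P) * D) = 'X * ('X * D - a%:P * D) by ring.
have -> : 'X^2 * (('X - a%:P) * D) = 'X * ('X^2 * D - a%:P * ('X * D)) by ring.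
rewrite ![('X * (_ - _))`_ _]coefXM /= !coefB !coefCM Dn D1.
by split; [ring | rewrite mulrnBl D2; ring].
Qed.
End PowerSums.

Section Exclusion.
Variables (k : fieldType) (char_k : 3%N \in [pchar k]).
Implicit Types (rs : seq (k * nat)).

(** The conditions of [two_root_discriminant] on the roots: the power sums with
    exponents 1 and -1 are [- D_11] and [- D_1 / D_0], and in characteristic 3
    those with exponents 2 and -2 are then [D_10] and [D_2 / D_0]. *)
Definition two_root_power_sums rs :=
  [/\ 0 \notin with_multiplicity rs,
      power_sum rs id = 0 /\ power_sum rs (fun a => a^-1) = 0,
      power_sum rs (fun a => a ^+ 2) != 0
    & (\prod_(x <- rs) x.1 ^+ x.2) * power_sum rs (fun a => a^-1 ^+ 2) ^+ 3
      = power_sum rs (fun a => a ^+ 2) ^+ 3].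

Lemma two_root_discriminant_power_sums rs :
    sumn (unzip2 rs) = 12%N -> two_root_discriminant (mult_prod rs) ->
  two_root_power_sums rs.
Proof.
rewrite -size_with_multiplicity mult_prodE => sz12.
rewrite /two_root_power_sums -!power_sumE.
have -> : \prod_(x <- rs) x.1 ^+ x.2 = \prod_(a <- with_multiplicity rs) a.
  rewrite big_flatten big_map; apply: eq_bigr => x _.
  by rewrite big_nseq iter_mulr_1.
set l := with_multiplicity rs in sz12 *.
set D := \prod_(a <- l) _ => -[[nz0 _] [z1 z11] nz2].
have D0 : D`_0 = \prod_(a <- l) a.
  by rewrite coef0_prod_XsubC sz12 -signr_odd mul1r.
have l0 : 0 \notin l.
  apply: contraNN nz0 => l0; rewrite D0 prodf_seq_eq0 /=.
  by apply/hasP; exists 0; rewrite //= eqxx.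
have D12 : D`_12 = 1.
  have /monicP := monic_prod_XsubC l xpredT id.
  by rewrite /lead_coef size_prod_XsubC sz12.
have [] := coef_prod_XsubC_low l0; rewrite -/D z1 => /esym/eqP.
rewrite oppr_eq0 mulf_eq0 (negPf nz0) /= => /eqP pN1.
rewrite pN1 expr0n sub0r -mulr_natr two_eqN1 // mulrN1 mulrN => /oppr_inj D2.
have [] := coef_prod_XsubC_top l; rewrite -/D sz12 coefXM /= z11 => /esym/eqP.
rewrite oppr_eq0 => /eqP p1.
rewrite p1 expr0n sub0r coefXnM /= -mulr_natr two_eqN1 // mulrN1 => /oppr_inj D10.
rewrite D12 expr1n mulr1 -D10 -D0 => eqD; split=> //.
  apply: contraNneq nz2 => z10; move/eqP: eqD; rewrite z10 expr0n mul0r.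
  by rewrite expf_eq0.
have nz02 : D`_0 ^+ 2 != 0 by rewrite expf_neq0.
apply: (mulIf nz02); rewrite -eqD D2; ring.
Qed.

(** ** Three exceptional partitions *)

(** If the common sum were nonzero, the pairs [a, a'] and [b, b'] would also
    have the same product, hence be equal. *)
Lemma opposite_pairs (a a' b b' : k) :
    [&& a != 0, a' != 0, b != 0 & b' != 0] -> a != b -> a != b' ->
    a + a' = b + b' -> a^-1 + a'^-1 = b^-1 + b'^-1 ->
  a' = - a /\ b' = - b.
Proof.
move=> /and4P[nza nza' nzb nzb'] neq_ab neq_ab' sum_eq inv_eq.
have prod_eq : (a + a') * (b * b' - a * a') = 0.
  have e1 : b * b' * (a + a') = a * a' * (b * b') * (a^-1 + a'^-1).
    by field; rewrite nza nza'.
  have e2 : a * a' * (b + b') = a * a' * (b * b') * (b^-1 + b'^-1).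
    by field; rewrite nzb nzb'.
  by rewrite mulrBr mulrC e1 inv_eq -e2 -sum_eq; ring.
have sum0 : a + a' = 0.
  have [//|nz] := eqVneq (a + a') 0.
  move/eqP: prod_eq; rewrite mulf_eq0 (negPf nz) subr_eq0 /= => /eqP eq_prod.
  have : (a - b) * (a - b') = 0.
    have -> : (a - b) * (a - b') = a * a - a * (b + b') + b * b' by ring.
    by rewrite -sum_eq eq_prod; ring.
  by move/eqP; rewrite mulf_eq0 !subr_eq0 (negPf neq_ab) (negPf neq_ab').
split; apply/eqP; first by rewrite -addr_eq0 addrC sum0.
by rewrite -addr_eq0 addrC -sum_eq sum0.
Qed.

Lemma two_sq_neq0 (a b : k) : a != b -> a != - b -> a ^+ 2 - b ^+ 2 != 0.
Proof. by move=> ab ab'; rewrite subr_sqr mulf_neq0 ?subr_eq0 ?addr_eq0. Qed.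

Lemma mulr2_char3 (x : k) : x *+ 2 = - x.
Proof. by rewrite -mulr_natr two_eqN1 // mulrN1. Qed.

Lemma mulrn_char3 (x : k) n : x *+ (n + 3) = x *+ n.
Proof. by rewrite mulrnDr -[x *+ 3]mulr_natl three_eq0 // mul0r addr0. Qed.

Lemma two_neq0 : 2%:R != 0 :> k.
Proof. by rewrite two_eqN1 // oppr_eq0 oner_neq0. Qed.

(** By [opposite_pairs] the roots are [a, -a] and [b, -b]. The last equation,
    [- a^8 b^4 (2/a^2 - 2/b^2)^3 = (2 a^2 - 2 b^2)^3], then reduces to
    [a^2 = b^2]. *)
Lemma no_two_root_7221 (a b c d : k) :
    let rs := [:: (a, 7); (b, 2); (c, 2); (d, 1)]%N in
  uniq (unzip1 rs) -> ~ two_root_power_sums rs.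
Proof.
move=> rs /=; rewrite !inE !negb_or -!andbA => /and4P[ab ac _ _].
case; rewrite /rs /with_multiplicity /power_sum /= !inE !negb_or !big_cons !big_nil /=.
rewrite !addr0 => nz.
have [nza nzb nzc nzd] : [/\ a != 0, b != 0, c != 0 & d != 0].
  by split; apply: contraTneq nz => ->; rewrite eqxx ?andbF.
have m7 x : x *+ 7 = x :> k by rewrite (mulrn_char3 _ 4) (mulrn_char3 _ 1).
rewrite !m7 !mulr2_char3 !mulr1n => -[p1 pN1] _.
have [|||||Ed Ec] := @opposite_pairs a d b c.
- by rewrite nza nzd nzb nzc.
- by [].
- by [].
- by apply/eqP; rewrite -subr_eq0 -p1; apply/eqP; ring.
- by apply/eqP; rewrite -subr_eq0 -pN1; apply/eqP; ring.
rewrite Ec in ac; have nzw := two_sq_neq0 ab ac.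
have nzW : (2%:R * (a ^+ 2 - b ^+ 2)) ^+ 3 != 0.
  by apply/expf_neq0/mulf_neq0; first exact: two_neq0.
rewrite Ed Ec => eqP3; case/eqP: nzw; apply/eqP; rewrite subr_eq0; apply/eqP.
suff eq1 : a ^+ 2 / b ^+ 2 = 1 by rewrite -[b ^+ 2]mul1r -eq1; field.
apply: (mulfI nzW); rewrite mulr1.
transitivity ((a ^+ 2 + (- b ^+ 2 + (- (- b) ^+ 2 + (- a) ^+ 2))) ^+ 3).
  by rewrite -eqP3; field; rewrite !oppr_eq0 nza nzb.
by ring.
Qed.

(** Modulo 3 the multiplicities 5 and 2 agree, as do 4 and 1, so the roots are
    [a, -a] and [b, -b] again, and the last equation reduces to [a = b]. *)
Lemma no_two_root_5421 (a b c d : k) :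
    let rs := [:: (a, 5); (b, 4); (c, 2); (d, 1)]%N in
  uniq (unzip1 rs) -> ~ two_root_power_sums rs.
Proof.
move=> rs /=; rewrite !inE !negb_or -!andbA => /and5P[ab _ ad _ _].
case; rewrite /rs /with_multiplicity /power_sum /= !inE !negb_or !big_cons !big_nil /=.
rewrite !addr0 => nz.
have [nza nzb nzc nzd] : [/\ a != 0, b != 0, c != 0 & d != 0].
  by split; apply: contraTneq nz => ->; rewrite eqxx ?andbF.
have m4 x : x *+ 4 = x :> k by rewrite (mulrn_char3 _ 1).
have m5 x : x *+ 5 = - x :> k by rewrite (mulrn_char3 _ 2) mulr2_char3.
rewrite !m4 !m5 !mulr2_char3 !mulr1n => -[p1 pN1] _.
have [|||||Ec Ed] := @opposite_pairs a c b d.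
- by rewrite nza nzd nzb nzc.
- by [].
- by [].
- by apply/eqP; rewrite eq_sym -subr_eq0 -p1; apply/eqP; ring.
- by apply/eqP; rewrite eq_sym -subr_eq0 -pN1; apply/eqP; ring.
rewrite Ed in ad; have nzw := two_sq_neq0 ab ad.
have nzW : (2%:R * (b ^+ 2 - a ^+ 2)) ^+ 3 != 0.
  apply/expf_neq0/mulf_neq0; first exact: two_neq0.
  by rewrite -opprB oppr_eq0.
rewrite Ed Ec => eqP3; case/eqP: ab.
suff eq1 : a / b = 1 by rewrite -[b]mul1r -eq1; field.
apply: (mulfI nzW); rewrite mulr1.
transitivity ((- a ^+ 2 + (b ^+ 2 + (- (- a) ^+ 2 + (- b) ^+ 2))) ^+ 3).
  by rewrite -eqP3; field; rewrite !oppr_eq0 nza nzb.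
by ring.
Qed.

(** Let [e1, e2, e3] be the elementary symmetric functions of [a, b, c]. The two
    vanishing power sums give [g = d + e1] and [e3 e1 + e2 g d = 0]. The power sum
    with exponent 2 is [Q = - (d e1 + e2)], the one with exponent -2 is
    [Q / (d e3)], and the last equation becomes [d^2 g = e3]. Together these
    relations imply [Q = 0]. *)
Lemma no_two_root_52221 (d a b c g : k) :
    let rs := [:: (d, 5); (a, 2); (b, 2); (c, 2); (g, 1)]%N in
  ~ two_root_power_sums rs.
Proof.
move=> rs; case.
rewrite /rs /with_multiplicity /power_sum /= !inE !negb_or !big_cons !big_nil /=.
rewrite !addr0 => nz.
have [nzd nza nzb nzc nzg] : [/\ d != 0, a != 0, b != 0, c != 0 & g != 0].
  by split; apply: contraTneq nz => ->; rewrite eqxx ?andbF.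
have m5 x : x *+ 5 = - x :> k by rewrite (mulrn_char3 _ 2) mulr2_char3.
rewrite !m5 !mulr2_char3 !mulr1n => -[p1 pN1].
pose e1 := a + b + c; pose e2 := a * b + b * c + c * a; pose e3 := a * b * c.
have Eg : g = d + e1 by apply/eqP; rewrite -subr_eq0 -p1 /e1; apply/eqP; ring.
have rel : e3 * e1 + e2 * g * d = 0.
  have -> : e1 = g - d by rewrite Eg; ring.
  transitivity (- (e3 * g * d) * (- d^-1 + (- a^-1 + (- b^-1 + (- c^-1 + g^-1))))).
    by rewrite /e2 /e3; field; rewrite nzd nza nzb nzc nzg.
  by rewrite pN1 mulr0.
set Q := (X in X != 0) => nzQ.
have EQ : Q = - (d * e1 + e2).
  transitivity (2%:R * (d * e1 + e2) + d ^+ 2 * 0).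
    by rewrite /Q Eg /e1 /e2; ring.
  by rewrite two_eqN1 //; ring.
have -> : - d^-1 ^+ 2 + (- a^-1 ^+ 2 + (- b^-1 ^+ 2 + (- c^-1 ^+ 2 + g^-1 ^+ 2)))
        = Q / (d * e3).
  have -> : g^-1 = d^-1 + (a^-1 + b^-1 + c^-1).
    by apply/eqP; rewrite -subr_eq0 -pN1; apply/eqP; ring.
  rewrite EQ; transitivity (2%:R * (d * e1 + e2) / (d * e3)).
    by rewrite /e1 /e2 /e3; field; rewrite nzd nza nzb nzc.
  by rewrite two_eqN1 // mulN1r.
have nz3 : e3 != 0 by rewrite !mulf_neq0.
move=> eqP3.
have eq_e3 : d ^+ 2 * g = e3.
  suff eq1 : d ^+ 2 * g / e3 = 1 by rewrite -[RHS]mul1r -eq1 divfK.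
  have nzQ3 : Q ^+ 3 != 0 by rewrite expf_neq0.
  apply: (mulfI nzQ3); rewrite mulr1 -[RHS]eqP3 /e3.
  by field; rewrite nzd nza nzb nzc.
case/eqP: nzQ; apply/eqP; rewrite EQ oppr_eq0.
have nzgd : g * d != 0 by rewrite mulf_neq0.
rewrite -(mulrI_eq0 _ (mulfI nzgd)) -rel -eq_e3; apply/eqP; ring.
Qed.
(** The vanishing of [D_11] and [D_10] says that [g = a + b + c] and
    [a b + b c + c a = 0], so that
    [(X - a) (X - b) (X - c) = X^2 (X - g) - e3] with [e3 = a b c]. This gives
    [D_9 = e3 - g^3], [D_8 = g e3] and [D_7 = g^2 e3], which contradict the
    remaining conditions. *)
Lemma no_double_root_52221 (a b c g : k) :
    let rs := [:: (0%R : k, 5); (a, 2); (b, 2); (c, 2); (g, 1)]%N in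
  ~ double_root_discriminant (mult_prod rs).
Proof.
move=> rs [_ [z11 z10] nz8 eq789].
have [] := coef_prod_XsubC_top (with_multiplicity rs).
rewrite -mult_prodE size_with_multiplicity coefXM coefXnM /= z11 z10 mul0rn.
rewrite !big_cons !big_nil /= => /esym/eqP; rewrite oppr_eq0 => /eqP sum1.
rewrite sum1 expr0n /= sub0r => /esym/eqP; rewrite oppr_eq0 => /eqP sum2.
pose e2 := a * b + b * c + c * a; pose e3 := a * b * c.
have Eg : g = a + b + c.
  apply/eqP; rewrite -subr_eq0 -sum1 -subr_eq0; apply/eqP.
  by transitivity (- (3%:R * (a + b + c))); [ring | rewrite three_eq0 // mul0r oppr0].
have z2 : e2 = 0.
  apply: (mulfI two_neq0); rewrite mulr0 -[RHS]sum2 Eg /e2.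
  apply/eqP; rewrite -subr_eq0; apply/eqP.
  transitivity (- (3%:R * (a ^+ 2 + b ^+ 2 + c ^+ 2))); first by ring.
  by rewrite three_eq0 // mul0r oppr0.
have ED : mult_prod rs =
    'X^12 - (g ^+ 3)%:P * 'X^9 + e3%:P * ('X^9 + g%:P * 'X^8 + (g ^+ 2)%:P * 'X^7)
    + (e3 ^+ 2)%:P * ('X^6 - g%:P * 'X^5).
  have Ecubic : ('X - a%:P) * ('X - b%:P) * ('X - c%:P) =
                'X^2 * ('X - g%:P) - e3%:P :> {poly k}.
    transitivity ('X^2 * ('X - g%:P) + e2%:P * 'X - e3%:P).
      by rewrite Eg /e2 /e3; ring.
    by rewrite z2 mul0r addr0.
  rewrite /mult_prod !big_cons big_nil /= subr0.
  transitivity ('X^5 * (('X - a%:P) * ('X - b%:P) * ('X - c%:P)) ^+ 2 * ('X - g%:P)).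
    by ring.
  rewrite Ecubic; apply/eqP; rewrite -subr_eq0; apply/eqP.
  transitivity (3%:R%:P * (g%:P * (g%:P - 'X) * 'X^10
     - e3%:P * ('X^9 - g%:P * 'X^8 + g%:P ^+ 2 * 'X^7))).
    by ring.
  by rewrite three_eq0 // mul0r.
have co n : (mult_prod rs)`_n = (n == 12%N)%:R - g ^+ 3 * (n == 9%N)%:R
    + e3 * ((n == 9%N)%:R + g * (n == 8%N)%:R + g ^+ 2 * (n == 7%N)%:R)
    + e3 ^+ 2 * ((n == 6%N)%:R - g * (n == 5%N)%:R).
  by rewrite ED !(coefD, coefN, coefCM, coefXn).
move: eq789 nz8; rewrite !co /= => /eqP; rewrite -subr_eq0 => /eqP eq789 nz8.
have : e3 * (g * e3) ^+ 3 = 0 by rewrite -[RHS]eq789; ring.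
have nz : g * e3 != 0 by apply: contraNneq nz8 => z8; apply/eqP; rewrite -[RHS]z8; ring.
move/eqP; rewrite mulf_eq0 expf_eq0 /= (negPf nz) orbF => /eqP z3.
by rewrite z3 mulr0 eqxx in nz.
Qed.
End Exclusion.

(** * Surfaces with a prescribed discriminant *)

Section Construction.
Variables (k : closedFieldType) (char_k : 3%N \in [pchar k]).
Implicit Types (D : {poly k}) (rs : seq (k * nat)).

Lemma has_nth_root n (c : k) : (0 < n)%N -> exists a, a ^+ n = c.
Proof.
move=> n_gt0; have [|a] := closed_rootP ('X^n - c%:P : {poly k}) _.
  by rewrite size_XnsubC // eqSS -lt0n.
by rewrite /root !hornerE subr_eq0 => /eqP; exists a.
Qed.

Lemma in_chart_scaleX (e : k) (P : P1 k) : in_chart 2 (e *: 'X) P = e *: 'X.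
Proof.
case: P => [a|] //=; apply/polyP=> i; rewrite coef_poly !coefZ !coefX.
by case: i => [|[|[|i]]] //=; rewrite ?mulr0.
Qed.

Lemma uniformizer_sqr_ndvd (e a : k) : e != 0 -> ~~ (('X - a%:P) ^+ 2 %| e *: 'X).
Proof.
move=> nz_e; apply: contraNN nz_e => dvd_eX; apply/contraT => nz_e.
have := dvdp_leq _ dvd_eX; rewrite scaler_eq0 (negPf nz_e) polyX_eq0 => /(_ isT).
by rewrite size_exp_XsubC size_scale // size_polyX.
Qed.

(** Minimality can only fail at a double zero of [b2], and [e X] has simple zeros
    on P^1. *)
Lemma minimal_two_root (e : k) c4 c6 P : e != 0 -> minimal_at (e *: 'X) c4 c6 P.
Proof.
move=> nz_e; rewrite /minimal_at in_chart_scaleX => -[r [dvd_eX _ _]].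
by have := uniformizer_sqr_ndvd (coordinate P) nz_e; rewrite dvd_eX.
Qed.

(** Take [b4 = a + c X^4] with [a^3 = D_0], [c^3 = D_12] and [e^2 = D_2 / a^2].
    The cube of [D_10 = e^2 c^2] is the hypothesis relating [D_2] and [D_10], and
    cubing is injective. Then [b4^3 + e^2 X^2 b4^2 - D] only has monomials of
    degrees 3 to 9, and [b6] is this difference divided by [e^3 X^3]. *)
Lemma two_root_discriminant_realized D :
    size D = 13%N -> two_root_discriminant D ->
  exists (e : k) (c4 c6 : {poly k}), [/\ e != 0, (size c4 <= 5)%N, (size c6 <= 7)%N
                    & discriminant (e *: 'X) c4 c6 = D].
Proof.
move=> szD [[nz0 nz12] [z1 z11] nz2 eqD].
have [a Ea] := has_nth_root D`_0 (isT : (0 < 3)%N).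
have [c Ec] := has_nth_root D`_12 (isT : (0 < 3)%N).
have [e Ee] := has_nth_root (D`_2 / a ^+ 2) (isT : (0 < 2)%N).
have nz_a : a != 0 by apply: contraNneq nz0 => a0; rewrite -Ea a0 expr0n.
have nz_c : c != 0 by apply: contraNneq nz12 => c0; rewrite -Ec c0 expr0n.
have nz_e : e != 0.
  apply: contraNneq nz2 => e0; move/eqP: Ee; rewrite e0 expr0n eq_sym /=.
  by rewrite mulf_eq0 invr_eq0 expf_eq0 (negPf nz_a) orbF.
have E2 : D`_2 = e ^+ 2 * a ^+ 2 by rewrite Ee divfK // expf_neq0.
have E10 : D`_10 = e ^+ 2 * c ^+ 2.
  have /eqP : (e ^+ 2 * c ^+ 2) ^+ 3 = D`_10 ^+ 3.
    have nza6 : D`_0 ^+ 2 != 0 by rewrite expf_neq0.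
    by apply: (mulIf nza6); rewrite -eqD E2 -Ea -Ec; ring.
  rewrite -subr_eq0 => /eqP cubes.
  have : (D`_10 - e ^+ 2 * c ^+ 2) ^+ 3 = 0.
    transitivity (- ((e ^+ 2 * c ^+ 2) ^+ 3 - D`_10 ^+ 3)
      + 3%:R * (D`_10 * e ^+ 2 * c ^+ 2 * (e ^+ 2 * c ^+ 2 - D`_10))); first by ring.
    by rewrite cubes three_eq0 // mul0r addr0 oppr0.
  by move/eqP; rewrite expf_eq0 subr_eq0 => /eqP.
pose c4 := a%:P + c *: 'X^4 : {poly k}.
have c4E i : c4`_i = a * (i == 0%N)%:R + c * (i == 4%N)%:R.
  by rewrite coefD coefC coefZ coefXn; case: (i == 0%N); rewrite ?mulr1 ?mulr0.
have sz4 : (size c4 <= 5)%N.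
  by apply/leq_sizeP=> i; rewrite c4E; case: i => [|[|[|[|[|i]]]]] //=; rewrite !mulr0 addr0.
pose R := c4 ^+ 3 + e ^+ 2 *: ('X^2 * c4 ^+ 2) - D.
have c4sqE : c4 ^+ 2 = (a ^+ 2)%:P + (a * c *+ 2) *: 'X^4 + (c ^+ 2) *: 'X^8.
  by rewrite /c4 -!mul_polyC; ring.
have RE i : (i < 3)%N || (9 < i)%N -> R`_i = 0.
  have [lt12i _|le_i12 le_i] := ltnP 12 i.
    have sz_cube : (size (c4 ^+ 3)%R <= 13)%N.
      by apply: leq_trans (size_poly_exp_leq _ _) _; move: sz4; lia.
    have sz_sqr : (size (e ^+ 2 *: ('X^2 * c4 ^+ 2))%R <= 13)%N.
      apply: leq_trans (size_scale_leq _ _) _; apply: leq_trans (size_polyMleq _ _) _.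
      by rewrite size_polyXn; move: (size_poly_exp_leq c4 2) sz4; lia.
    rewrite nth_default // (leq_trans _ lt12i) // (leq_trans (size_polyD _ _)) //.
    rewrite size_polyN szD geq_max leqnn andbT (leq_trans (size_polyD _ _)) //.
    by rewrite geq_max sz_cube sz_sqr.
  have : i \in [:: 0; 1; 2; 10; 11; 12]%N.
    by rewrite !inE; move: le_i12 le_i; lia.
  rewrite /R coefB coefD coef_cube // c4E coefZ coefXnM c4sqE.
  rewrite !coefD coefC !coefZ !coefXn !inE.
  case/or4P => [/eqP->|/eqP->|/eqP->|/or3P[]/eqP->] /=.
  - by rewrite -Ea; ring.
  - by rewrite z1; ring.
  - by rewrite E2; ring.
  - by rewrite E10; ring.
  - by rewrite z11; ring.
  - by rewrite -Ec; ring.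
exists e, c4, (e ^- 3 *: \poly_(i < 7) R`_(i + 3)); split=> //.
  exact: leq_trans (size_scale_leq _ _) (size_poly _ _).
have nz_e3 : e ^+ 3 != 0 by rewrite expf_neq0.
have ER : 'X^3 * \poly_(i < 7) R`_(i + 3) = R.
  apply/polyP=> i; rewrite coefXnM; case: ltnP => [lt_i3|le3i].
    by rewrite RE ?lt_i3.
  rewrite coef_poly; case: ltnP => [_|le_i]; first by rewrite subnK.
  by rewrite RE //; move: le_i le3i; lia.
transitivity (c4 ^+ 3 + e ^+ 2 *: ('X^2 * c4 ^+ 2)
              - (e ^+ 3 * e ^- 3) *: ('X^3 * \poly_(i < 7) R`_(i + 3))).
  by rewrite /discriminant -scalerA -!mul_polyC !polyC_exp; ring.
by rewrite divff // scale1r ER /R opprB addrCA subrr addr0.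
Qed.
Lemma mup_mult_prod rs x :
  uniq (unzip1 rs) -> x \in rs -> mup x.1 (mult_prod rs) = x.2.
Proof.
have mupE a us : mup a (mult_prod us) = (\sum_(y <- us | y.1 == a) y.2)%N.
  elim: us => [|y us IHus]; first by rewrite /mult_prod !big_nil mupNroot ?root1.
  rewrite mult_prod_cons mupM ?expf_neq0 ?polyXsubC_eq0 ?mult_prod_neq0 //.
  by rewrite mup_XsubCX big_cons IHus; case: eqP.
rewrite mupE; elim: rs => // y rs IHrs /= /andP[y_rs uniq_rs].
rewrite inE big_cons => /predU1P[-> | x_rs].
  rewrite eqxx big1_seq ?addn0 // => z /andP[/eqP eq_zy z_rs].
  by case/negP: y_rs; rewrite -eq_zy map_f.
case: eqP => [eq_yx|_]; last exact: IHrs.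
by case/negP: y_rs; rewrite eq_yx map_f.
Qed.

Lemma root_mult_prod rs a :
  0%N \notin unzip2 rs -> root (mult_prod rs) a = (a \in unzip1 rs).
Proof.
elim: rs => [|[b n] rs IHrs]; first by rewrite /mult_prod big_nil (negPf (root1 _)).
rewrite !inE negb_or => /andP[n_gt0 /IHrs rootP].
rewrite mult_prod_cons rootM rootP /=; case: n n_gt0 => // n _.
by rewrite root_exp_XsubC.
Qed.

Lemma two_root_surface rs :
    uniq (unzip1 rs) -> 0%N \notin unzip2 rs -> sumn (unzip2 rs) = 12%N ->
    two_root_discriminant (mult_prod rs) ->
  exists X : rational_elliptic_surface k,
    has_configuration X (unzip2 rs) /\ b2_distinct_roots X.
Proof.
move=> uniq_rs rs_gt0 sum12 split_rs.
have szD : size (mult_prod rs) = 13%N by rewrite size_mult_prod sum12.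
have [e [c4 [c6 [nz_e sz4 sz6 ED]]]] := two_root_discriminant_realized szD split_rs.
have sz2 : (size (e *: 'X : {poly k}) <= 3)%N.
  by rewrite (leq_trans (size_scale_leq _ _)) // size_polyX.
have nzD : discriminant (e *: 'X) c4 c6 != 0 by rewrite ED mult_prod_neq0.
pose X := RationalEllipticSurface sz2 sz4 sz6 nzD
            (fun P => @minimal_two_root e c4 c6 P nz_e).
have singX P : singular_fibre X P = (P \in map Some (unzip1 rs)).
  rewrite /singular_fibre /surface_discriminant /= /vanishes.
  case: P => [a|] /=; rewrite ED.
    by rewrite root_mult_prod // mem_map // => ? ? [].
  have [[_ nz12] _ _ _] := split_rs.
  rewrite /root horner_coef0 coef_poly subn0 (negPf nz12).
  by apply/esym/mapP => -[].
exists X; split; first split.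
- move=> P singP; rewrite /multiplicative_fibre singP /vanishes /= in_chart_scaleX.
  move: singP; rewrite singX => /mapP[a]; rewrite -root_mult_prod // => root_a -> /=.
  apply: contraTN root_a; rewrite /root !hornerE mulf_eq0 (negPf nz_e) => /eqP->.
  by have [[nz0 _] _ _ _] := split_rs; rewrite horner_coef0.
- exists (map Some (unzip1 rs)); split.
  + by rewrite map_inj_uniq // => ? ? [].
  + by move=> P; rewrite singX.
  + suff -> : unzip2 rs = [seq fibre_index X P | P <- map Some (unzip1 rs)] by [].
    rewrite -!map_comp; apply/eq_in_map => x x_rs.
    by rewrite /fibre_index /vanishing_order /surface_discriminant /= ED mup_mult_prod //.
- split=> [|P /=]; first by rewrite scaler_eq0 (negPf nz_e) polyX_eq0.
  rewrite /vanishing_order in_chart_scaleX leqNgt mup_geq.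
    exact: uniformizer_sqr_ndvd.
  by rewrite scaler_eq0 (negPf nz_e) polyX_eq0.
Qed.
End Construction.

(** * Changes of coordinate on the projective line *)

Section Homogeneous.
Variable k : fieldType.
Implicit Types (p q x y : {poly k}).

(** A polynomial of degree at most [n], seen as a section of O(n), after a linear
    change of the homogeneous coordinates. *)
Definition hsubst n p x y : {poly k} :=
  \sum_(i < n.+1) p`_i *: (x ^+ i * y ^+ (n - i)).

Lemma size_hsubst n p x y :
  (size x <= 2)%N -> (size y <= 2)%N -> (size (hsubst n p x y) <= n.+1)%N.
Proof.
move=> szx szy; apply: leq_trans (size_sum _ _ _) _; apply/bigmax_leqP=> i _.
apply: leq_trans (size_scale_leq _ _) _; apply: leq_trans (size_polyMleq _ _) _.
have := size_poly_exp_leq x i; have := size_poly_exp_leq y (n - i).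
by have := ltn_ord i; move: szx szy; nia.
Qed.

Lemma size_discriminant (c2 c4 c6 : {poly k}) :
    (size c2 <= 3)%N -> (size c4 <= 5)%N -> (size c6 <= 7)%N ->
  (size (discriminant c2 c4 c6) <= 13)%N.
Proof.
move=> sz2 sz4 sz6.
have szX (p : {poly k}) m n : (size p <= m.+1)%N -> (size (p ^+ n) <= (m * n).+1)%N.
  by move=> sz; apply: leq_trans (size_poly_exp_leq _ _) _; nia.
have szM (p q : {poly k}) m n :
    (size p <= m.+1)%N -> (size q <= n.+1)%N -> (size (p * q)%R <= (m + n).+1)%N.
  by move=> szp szq; apply: leq_trans (size_polyMleq _ _) _; lia.
have szD (p q : {poly k}) n :
    (size p <= n)%N -> (size q <= n)%N -> (size (p + q)%R <= n)%N.
  by move=> szp szq; apply: leq_trans (size_polyD _ _) _; rewrite geq_max szp.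
rewrite /discriminant; apply: (szD); last exact: (szX c4 4 3)%N.
apply: (szM _ _ 4 8)%N; first by rewrite size_polyN; apply: (szX c2 2 2)%N.
apply: (szD); first exact: (szM _ _ 2 6)%N.
by rewrite size_polyN; apply: (szX c4 4 2)%N.
Qed.

Section FractionEvaluation.
Variables (x y : {poly k}) (nz_y : y != 0).

(** Homogeneous substitution of degree [n] is [y^n] times the evaluation at
    [x / y], which is a ring morphism; this makes its compatibility with products
    immediate. *)
Definition frac_eval p : {fraction {poly k}} :=
  (map_poly (@tofrac {poly k} \o polyC) p).[tofrac x / tofrac y].

Lemma frac_evalD p q : frac_eval (p + q) = frac_eval p + frac_eval q.
Proof. by rewrite /frac_eval rmorphD hornerD. Qed.

Lemma frac_evalN p : frac_eval (- p) = - frac_eval p.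
Proof. by rewrite /frac_eval rmorphN hornerN. Qed.

Lemma frac_evalM p q : frac_eval (p * q) = frac_eval p * frac_eval q.
Proof. by rewrite /frac_eval rmorphM hornerM. Qed.

Lemma frac_evalX p n : frac_eval (p ^+ n) = frac_eval p ^+ n.
Proof. by rewrite /frac_eval rmorphXn horner_exp. Qed.

Lemma frac_evalC (c : k) : frac_eval c%:P = tofrac c%:P.
Proof. by rewrite /frac_eval map_polyC hornerC. Qed.

Lemma tofrac_hsubst n p : (size p <= n.+1)%N ->
  tofrac (hsubst n p x y) = tofrac y ^+ n * frac_eval p.
Proof.
move=> szp; have nz_fy : tofrac y != 0 by rewrite tofrac_eq0.
rewrite /frac_eval (@horner_coef_wide _ n.+1) ?size_map_poly //.
rewrite rmorph_sum mulr_sumr; apply: eq_bigr => i _ /=.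
rewrite coef_map /= -mul_polyC !(tofracM, tofracXn) expr_div_n.
rewrite [RHS]mulrCA; congr (_ * _).
have -> : tofrac y ^+ n = tofrac y ^+ (n - i) * tofrac y ^+ i.
  by rewrite -exprD subnK // -ltnS.
by rewrite mulrACA -mulrA divff ?expf_neq0 // mulr1 mulrC.
Qed.

Lemma hsubst_discriminant (c2 c4 c6 : {poly k}) :
    (size c2 <= 3)%N -> (size c4 <= 5)%N -> (size c6 <= 7)%N ->
  discriminant (hsubst 2 c2 x y) (hsubst 4 c4 x y) (hsubst 6 c6 x y) =
  hsubst 12 (discriminant c2 c4 c6) x y.
Proof.
move=> sz2 sz4 sz6; apply/eqP; rewrite -tofrac_eq; apply/eqP.
rewrite [RHS]tofrac_hsubst ?size_discriminant // /discriminant.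
rewrite !(frac_evalD, frac_evalN, frac_evalM, frac_evalX, mulNr).
rewrite !(tofracD, tofracN, tofracM, tofracXn) !tofrac_hsubst //.
by ring.
Qed.
End FractionEvaluation.
End Homogeneous.

Section Points.
Variable k : fieldType.
Implicit Types (P Q R : P1 k).

(** The coefficients of a linear form vanishing at the point. *)
Definition coords P : k * k := if P is Some a then (1, - a) else (0, 1).

Definition bracket P Q : k :=
  (coords P).1 * (coords Q).2 - (coords P).2 * (coords Q).1.

Definition linear_form P : {poly k} := (coords P).1 *: 'X + (coords P).2%:P.

Lemma linear_form_Some a : linear_form (Some a) = 'X - a%:P.
Proof. by rewrite /linear_form /= scale1r polyCN. Qed.

Lemma linear_form_None : linear_form None = 1.
Proof. by rewrite /linear_form /= scale0r add0r. Qed.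

Lemma bracket_eq0 P Q : (bracket P Q == 0) = (P == Q).
Proof.
rewrite /bracket; case: P Q => [a|] [b|] /=.
- rewrite mul1r mulr1 opprK addrC subr_eq0.
  by apply/eqP/eqP => [->|[->]].
- by rewrite mulr1 mulr0 subr0 oner_eq0.
- by rewrite mul0r mulr1 sub0r oppr_eq0 oner_eq0.
- by rewrite mul0r mulr0 subrr !eqxx.
Qed.

Lemma bracketC P Q : bracket Q P = - bracket P Q.
Proof. by rewrite /bracket; ring. Qed.

Lemma plucker P Q R S :
  bracket R P * bracket S Q - bracket S P * bracket R Q =
  bracket R S * bracket P Q.
Proof. by rewrite /bracket; ring. Qed.

Lemma size_linear_form P : (size (linear_form P) <= 2)%N.
Proof.
case: P => [a|]; last by rewrite linear_form_None size_poly1.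
by rewrite linear_form_Some size_XsubC.
Qed.

Section Chart.
Variables (P Q : P1 k) (neq_PQ : P != Q).

(** The change of coordinate sending [P] to 0 and [Q] to oo: the linear form of a
    point [R] becomes [bracket R Q * X - bracket R P]. *)
Definition chart_x : {poly k} := (coords Q).2 *: 'X - (coords P).2%:P.
Definition chart_y : {poly k} := (coords P).1%:P - (coords Q).1 *: 'X.

Definition chart_coordinate R : k := bracket R P / bracket R Q.

Lemma chart_y_neq0 : chart_y != 0.
Proof.
have := neq_PQ; rewrite -bracket_eq0 /bracket; apply: contraNneq => y0.
have e0 : chart_y`_0 = 0 by rewrite y0 coef0.
have e1 : chart_y`_1 = 0 by rewrite y0 coef0.
move: e1 e0; rewrite /chart_y !coefB !coefC !coefZ !coefX /= mulr0 mulr1.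
rewrite sub0r subr0 => /eqP; rewrite oppr_eq0 => /eqP-> ->.
by rewrite mul0r mulr0 subrr.
Qed.

Lemma size_chart_x : (size chart_x <= 2)%N.
Proof.
apply/leq_sizeP => -[|[|i]] // _.
by rewrite /chart_x coefB coefZ coefX coefC mulr0 subr0.
Qed.

Lemma size_chart_y : (size chart_y <= 2)%N.
Proof.
apply/leq_sizeP => -[|[|i]] // _.
by rewrite /chart_y coefB coefZ coefX coefC mulr0 subr0.
Qed.

Lemma chart_linear_form R :
  tofrac chart_y * frac_eval chart_x chart_y (linear_form R) =
  tofrac (bracket R Q *: 'X - (bracket R P)%:P).
Proof.
rewrite -[tofrac chart_y]expr1 -tofrac_hsubst ?chart_y_neq0 ?size_linear_form //.
congr tofrac; rewrite /hsubst !big_ord_recl big_ord0 /=.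
rewrite /linear_form !coefD !coefZ !coefX !coefC /= /chart_x /chart_y /bracket.
by rewrite -!mul_polyC; ring.
Qed.

Lemma chart_coordinate_inj R S : R != Q -> S != Q ->
  chart_coordinate R = chart_coordinate S -> R = S.
Proof.
rewrite -!bracket_eq0 => nzR nzS /eqP; rewrite /chart_coordinate.
rewrite eqr_div // -subr_eq0 plucker mulf_eq0 !bracket_eq0 (negPf neq_PQ) orbF.
by move/eqP.
Qed.
End Chart.
End Points.

(** * Reduction to standard position *)

Section NormalForm.
Variables (k : closedFieldType) (char_k : 3%N \in [pchar k]).
Implicit Types (D : {poly k}) (rs : seq (k * nat)) (P Q R : P1 k).

Lemma prod_mup D : D != 0 ->
  exists r : seq k, [/\ uniq r, forall a, (a \in r) = root D a
    & D = lead_coef D *: \prod_(a <- r) ('X - a%:P) ^+ mup a D].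
Proof.
move=> nzD; have [r ED] := closed_field_poly_normal D.
have nz_c : lead_coef D != 0 by rewrite lead_coef_eq0.
exists (undup r); split=> [|a|]; first exact: undup_uniq.
  by rewrite mem_undup ED rootZ // root_prod_XsubC.
rewrite [LHS]ED -prodr_undup_exp_count; congr (_ *: _); apply: eq_big_seq => a a_r.
pose rs := [seq (b, count_mem b r) | b <- undup r].
have Ers : D = (lead_coef D)%:P * mult_prod rs.
  by rewrite mul_polyC {1}ED -prodr_undup_exp_count /mult_prod big_map.
have uniq_rs : uniq (unzip1 rs) by rewrite /unzip1 -map_comp [map _ _]map_id undup_uniq.
have a_rs : (a, count_mem a r) \in rs by apply/mapP; exists a.
rewrite Ers mupMr ?rootC //.
by have := mup_mult_prod uniq_rs a_rs => /= ->.
Qed.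

(** The linear form of the point at oo is 1, so that this point contributes a
    trivial factor. *)
Lemma prod_vanishing_order n D (ps : seq (P1 k)) :
    D != 0 -> uniq ps -> (forall P, (P \in ps) = vanishes n D P) ->
  D = lead_coef D *: \prod_(P <- ps) linear_form P ^+ vanishing_order n D P.
Proof.
move=> nzD uniq_ps psE; have [r [uniq_r rE ED]] := prod_mup nzD.
rewrite {1}ED; congr (_ *: _).
have Eps : perm_eq (pmap id ps) r.
  apply: uniq_perm => // [|a]; first by apply: (@pmap_uniq _ _ id Some) => // -[].
  by rewrite mem_pmap map_id rE psE.
rewrite -(perm_big _ Eps) big_pmap; apply: eq_bigr => -[a|] _ /=.
  by rewrite linear_form_Some.
by rewrite linear_form_None expr1n.
Qed.

Lemma vanishes_linear_form (c : k) P Q :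
  vanishes 2 (c *: (linear_form P * linear_form Q)) P.
Proof.
rewrite /vanishes; case: P => [a|] /=.
  by rewrite linear_form_Some /root hornerZ hornerM hornerXsubC subrr mul0r mulr0.
rewrite /root horner_coef0 coef_poly /= linear_form_None mul1r coefZ.
have := size_linear_form Q => szQ.
by rewrite nth_default // mulr0.
Qed.

Lemma factor_quadratic (p : {poly k}) : p != 0 -> (size p <= 3)%N ->
  exists (c : k) P Q, c != 0 /\ p = c *: (linear_form P * linear_form Q).
Proof.
move=> nz_p sz_p; have [r] := closed_field_poly_normal p.
have : lead_coef p != 0 by rewrite lead_coef_eq0.
move: (lead_coef p) => c nz_c Ep; exists c.
have : (size r <= 2)%N by rewrite Ep size_scale // size_prod_XsubC in sz_p.
rewrite Ep; case: r {Ep} => [|a [|b []]] // _.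
- by exists None, None; rewrite !linear_form_None big_nil mulr1.
- exists (Some a), None.
  by rewrite linear_form_None linear_form_Some big_seq1 mulr1.
- exists (Some a), (Some b).
  by rewrite !linear_form_Some !big_cons big_nil mulr1.
Qed.

(** Every singular fibre lies over a finite point of the new coordinate, because
    [Q], which is sent to oo, has a smooth fibre. *)
Lemma discriminant_in_chart (c2 c4 c6 : {poly k}) (ps : seq (P1 k)) P Q :
    let D := discriminant c2 c4 c6 in
    (size c2 <= 3)%N -> (size c4 <= 5)%N -> (size c6 <= 7)%N -> D != 0 ->
    uniq ps -> (forall R, (R \in ps) = vanishes 12 D R) ->
    (\sum_(R <- ps) vanishing_order 12 D R)%N = 12%N ->
    P != Q -> Q \notin ps ->
    let rs := [seq (chart_coordinate P Q R, vanishing_order 12 D R) | R <- ps] in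
  uniq (unzip1 rs) /\ exists c (d4 d6 : {poly k}),
    [/\ c != 0, (size d4 <= 5)%N, (size d6 <= 7)%N
      & discriminant (hsubst 2 c2 (chart_x P Q) (chart_y P Q)) d4 d6 =
        c *: mult_prod rs].
Proof.
move=> D sz2 sz4 sz6 nzD uniq_ps psE sum12 neq_PQ Q_ps rs.
have neq_Q R : R \in ps -> R != Q by apply: contraTneq => ->.
split.
  rewrite /unzip1 -map_comp map_inj_in_uniq // => R S R_ps S_ps /=.
  by apply: (chart_coordinate_inj neq_PQ); rewrite neq_Q.
have nz_y := chart_y_neq0 neq_PQ.
exists (lead_coef D * \prod_(R <- ps) bracket R Q ^+ vanishing_order 12 D R).
exists (hsubst 4 c4 (chart_x P Q) (chart_y P Q)).
exists (hsubst 6 c6 (chart_x P Q) (chart_y P Q)).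
split; try exact: (size_hsubst _ _ (size_chart_x P Q) (size_chart_y P Q)).
  rewrite mulf_neq0 ?lead_coef_eq0 // prodf_seq_neq0; apply/allP => R R_ps /=.
  by rewrite expf_neq0 // bracket_eq0 neq_Q.
rewrite hsubst_discriminant // -/D; apply/eqP; rewrite -tofrac_eq; apply/eqP.
rewrite tofrac_hsubst ?size_discriminant //.
pose n R := vanishing_order 12 D R.
have -> : tofrac (chart_y P Q) ^+ 12 = \prod_(R <- ps) tofrac (chart_y P Q) ^+ n R.
  by rewrite prodrXr sum12.
rewrite {1}(prod_vanishing_order nzD uniq_ps psE) -!mul_polyC frac_evalM frac_evalC.
rewrite polyCM 2!tofracM mulrCA -mulrA; congr (_ * _).
rewrite (big_morph _ (frac_evalM _ _) (frac_evalC _ _ 1)) -big_split /=.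
rewrite /mult_prod big_map rmorph_prod -tofracM -big_split /= rmorph_prod.
apply: eq_big_seq => R R_ps /=.
rewrite frac_evalX -exprMn chart_linear_form // -tofracXn; congr tofrac.
rewrite polyC_exp -exprMn; congr (_ ^+ _).
rewrite mulrBr -polyCM mul_polyC /chart_coordinate mulrC divfK //.
by rewrite bracket_eq0 neq_Q.
Qed.
(** The equation between the coefficients is homogeneous of degree 5. *)
Lemma two_root_discriminantZ (c : k) D :
  c != 0 -> two_root_discriminant (c *: D) -> two_root_discriminant D.
Proof.
rewrite /two_root_discriminant !coefZ => nz_c [[nz0 nz12] [z1 z11] nz2 eqD].
have nzr x : c * x != 0 -> x != 0 by apply: contraNneq => ->; rewrite mulr0.
have zr x : c * x = 0 -> x = 0 by move/eqP; rewrite mulf_eq0 (negPf nz_c) => /eqP.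
split; [by split; exact: nzr | by split; exact: zr | exact: nzr |].
have nz_c5 : c ^+ 5 != 0 by rewrite expf_neq0.
apply: (mulfI nz_c5); transitivity ((c * D`_2) ^+ 3 * (c * D`_12) ^+ 2); first by ring.
by rewrite eqD; ring.
Qed.

(** The equation between the coefficients is homogeneous of degree 4. *)
Lemma double_root_discriminantZ (c : k) D :
  c != 0 -> double_root_discriminant (c *: D) -> double_root_discriminant D.
Proof.
rewrite /double_root_discriminant !coefZ => nz_c [nz12 [z11 z10] nz8 eqD].
have nzr x : c * x != 0 -> x != 0 by apply: contraNneq => ->; rewrite mulr0.
have zr x : c * x = 0 -> x = 0 by move/eqP; rewrite mulf_eq0 (negPf nz_c) => /eqP.
split; [exact: nzr | by split; exact: zr | exact: nzr |].
have nz_c4 : c ^+ 4 != 0 by rewrite expf_neq0.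
apply: (mulfI nz_c4); transitivity ((c * D`_7) ^+ 3 * (c * D`_12)); first by ring.
by rewrite eqD; ring.
Qed.

(** With [b2] proportional to the product of the linear forms of two points [P0]
    and [Q], neither of which is below a singular fibre, [Q] is sent to oo. If
    [P0] differs from [Q] it is sent to 0. Otherwise the point sent to 0 is
    arbitrary, and it is taken below a fibre of a given type I_n. *)
Lemma configuration_normal_form (X : rational_elliptic_surface k) s :
    is_partition 12 s -> has_configuration X s ->
  (exists rs, [/\ uniq (unzip1 rs), perm_eq s (unzip2 rs)
                & two_root_discriminant (mult_prod rs)]) \/
  (forall n, n \in s -> exists rs,
     [/\ (0, n) \in rs, perm_eq s (unzip2 rs)
       & double_root_discriminant (mult_prod rs)]).
Proof.
case/and3P=> _ s_gt0 /eqP sum_s [multX [ps [uniq_ps psE s_ps]]].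
have sum12 : (\sum_(R <- ps) fibre_index X R)%N = 12%N.
  by rewrite -sum_s (perm_sumn s_ps) sumnE big_map.
have nz_b2 : b2 X != 0.
  apply: contraTneq isT => b2_0; case: ps psE sum12 {uniq_ps s_ps} => [|P ps psE _].
    by move=> _; rewrite big_nil.
  have /multX/andP[_ /negP[]] : singular_fibre X P by rewrite -psE mem_head.
  rewrite b2_0 /vanishes /in_chart; case: P {psE} => [a|]; first exact: root0.
  by rewrite /root horner_coef0 coef_poly coef0.
have [c [P0 [Q [nz_c Eb2]]]] := factor_quadratic nz_b2 (deg_b2 X).
have vanish_P0 : vanishes 2 (b2 X) P0 by rewrite Eb2 vanishes_linear_form.
have vanish_Q : vanishes 2 (b2 X) Q by rewrite Eb2 mulrC vanishes_linear_form.
have notin_ps P : vanishes 2 (b2 X) P -> P \notin ps.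
  by move=> van; rewrite psE; apply/negP => /multX/andP[_]; rewrite van.
have eval_b2 P (neq_PQ : P != Q) :
    hsubst 2 (b2 X) (chart_x P Q) (chart_y P Q) =
    c *: ((bracket P0 Q *: 'X - (bracket P0 P)%:P) * (bracket P Q)%:P).
  have nz_y := chart_y_neq0 neq_PQ; apply/eqP; rewrite -tofrac_eq; apply/eqP.
  rewrite tofrac_hsubst ?deg_b2 // Eb2 -!mul_polyC !(frac_evalM, frac_evalC).
  rewrite expr2 mulrCA mulrACA !chart_linear_form // -!tofracM.
  have /eqP -> : bracket Q Q == 0 by rewrite bracket_eq0.
  by rewrite scale0r sub0r (bracketC P Q) polyCN opprK !mul_polyC.
have chart P (neq_PQ : P != Q) := discriminant_in_chart (deg_b2 X) (deg_b4 X)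
  (deg_b6 X) (discriminant_neq0 X) uniq_ps psE sum12 neq_PQ (notin_ps _ vanish_Q).
have perm_rs (f : P1 k -> k) :
    perm_eq s (unzip2 [seq (f R, fibre_index X R) | R <- ps]).
  by rewrite /unzip2 -map_comp.
have top_rs (f : P1 k -> k) d : d != 0 ->
    (d *: mult_prod [seq (f R, fibre_index X R) | R <- ps])`_12 != 0.
  move=> nz_d; rewrite coefZ mulf_neq0 //.
  set rs := map _ _; have := monicP (mult_prod_monic rs).
  by rewrite /lead_coef size_mult_prod -(perm_sumn (perm_rs f)) sum_s /= => ->; rewrite oner_neq0.
have [eq_P0Q|neq_P0Q] := eqVneq P0 Q; [right=> n n_s | left].
  have [P P_ps En] : exists2 P, P \in ps & n = fibre_index X P.
    by move: n_s; rewrite (perm_mem s_ps) => /mapP.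
  have neq_PQ : P != Q by apply: contraTneq P_ps => ->; exact: notin_ps.
  have [_ [d [d4 [d6 [nz_d sz4 sz6 ED]]]]] := chart P neq_PQ.
  exists [seq (chart_coordinate P Q R, fibre_index X R) | R <- ps]; split=> //.
    apply/mapP; exists P => //; rewrite En /chart_coordinate.
    have /eqP -> : bracket P P == 0 by rewrite bracket_eq0.
    by rewrite mul0r.
  pose e := c * (- bracket Q P * bracket P Q).
  have nz_e : e != 0.
    by rewrite !mulf_neq0 ?oppr_eq0 ?bracket_eq0 // eq_sym.
  have Ee : hsubst 2 (b2 X) (chart_x P Q) (chart_y P Q) = e%:P.
    rewrite eval_b2 // eq_P0Q; have /eqP -> : bracket Q Q == 0 by rewrite bracket_eq0.
    by rewrite scale0r sub0r -polyCN -polyCM -mul_polyC -polyCM.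
  rewrite Ee in ED; apply: (double_root_discriminantZ nz_d); rewrite -ED.
  by apply: double_root_discriminant_of => //; rewrite ED; exact: top_rs.
have [uniq_rs [d [d4 [d6 [nz_d sz4 sz6 ED]]]]] := chart P0 neq_P0Q.
set rs := map _ ps in uniq_rs ED.
exists rs; split=> //; first exact: perm_rs.
pose e := c * (bracket P0 Q * bracket P0 Q).
have nz_e : e != 0 by rewrite !mulf_neq0 ?bracket_eq0.
have Ee : hsubst 2 (b2 X) (chart_x P0 Q) (chart_y P0 Q) = e *: 'X.
  rewrite eval_b2 //; have /eqP -> : bracket P0 P0 == 0 by rewrite bracket_eq0.
  by rewrite subr0 -!mul_polyC /e !polyCM; ring.
rewrite Ee in ED; apply: (two_root_discriminantZ nz_d); rewrite -ED.
apply: two_root_discriminant_of => //; rewrite ED; last exact: top_rs.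
rewrite coefZ mulf_neq0 // -horner_coef0 -/(root _ _) root_mult_prod; last first.
  by rewrite -(perm_mem (perm_rs _)).
rewrite /rs /unzip1 -map_comp; apply/mapP => -[R R_ps /= /esym/eqP].
rewrite /chart_coordinate mulf_eq0 invr_eq0 !bracket_eq0 => /orP[]/eqP ER.
  by have := notin_ps _ vanish_P0; rewrite -ER R_ps.
by have := notin_ps _ vanish_Q; rewrite -ER R_ps.
Qed.
End NormalForm.

(** * Factorizations over the field with nine elements *)

Section NineArithmetic.
Local Open Scope nat_scope.

(** The element [a + b i] of the field with nine elements, where [i^2 = -1], is
    encoded by the number [a + 3 b] with [a, b < 3]. *)
Definition add9 m n := (m %% 3 + n %% 3) %% 3 + 3 * ((m %/ 3 + n %/ 3) %% 3).

Definition mul9 m n :=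
  (m %% 3 * (n %% 3) + 2 * (m %/ 3 * (n %/ 3))) %% 3
  + 3 * ((m %% 3 * (n %/ 3) + m %/ 3 * (n %% 3)) %% 3).

Definition unit9 n := has (fun m => mul9 m n == 1) (iota 0 9).

Definition cube9 n := mul9 n (mul9 n n).

(** Polynomials over the field with nine elements are lists of coefficients, the
    constant term first. *)
Fixpoint addp (s t : seq nat) : seq nat :=
  match s, t with
  | [::], _ => t
  | _, [::] => s
  | m :: s', n :: t' => add9 m n :: addp s' t'
  end.

Definition scalep m (s : seq nat) := [seq mul9 m n | n <- s].

Fixpoint mulp (s t : seq nat) : seq nat :=
  if s is m :: s' then addp (scalep m t) (0 :: mulp s' t) else [::].

Definition prodp (ss : seq (seq nat)) : seq nat := foldr mulp [:: 1] ss.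

Fixpoint derivp (s : seq nat) : seq nat :=
  if s is _ :: s' then addp s' (0 :: derivp s') else [::].

(** Certifies that two polynomials have no common root other than 0. If [p] and
    [q] have constant terms [m] and [n], then [n p - m q] is divisible by [X], and
    the quotient can replace the longer of the two; 2 stands for -1. *)
Fixpoint no_common_root fuel (s t : seq nat) : bool :=
  match fuel, s, t with
  | fuel'.+1, m :: s', n :: t' =>
      if m == 0 then no_common_root fuel' s' t
      else if n == 0 then no_common_root fuel' s t'
      else if nilp s' then unit9 m
      else if nilp t' then unit9 n
      else
        let u := addp (scalep n s') (scalep (mul9 2 m) t') in
        if size t <= size s then no_common_root fuel' u t
        else no_common_root fuel' s u
  | _, _, _ => false
  end.
End NineArithmetic.

(** One entry for each partition: a pair [(n, f)] stands for the factor [f^n] of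
    the discriminant, so that the fibres over the roots of [f] have type I_n. *)
Definition factorizations : seq (seq (nat * seq nat)) :=
  [::
    [:: (1, [:: 1; 0; 2; 1; 2; 1; 0; 2; 1; 1; 2; 0; 1])];
    [:: (2, [:: 1; 1]); (1, [:: 1; 1; 1; 0; 0; 0; 0; 1; 1; 1; 1])];
    [:: (3, [:: 1; 1]); (1, [:: 1; 0; 1; 0; 0; 0; 1; 1; 0; 1])];
    [:: (2, [:: 1; 0; 1]); (1, [:: 1; 0; 0; 0; 0; 0; 0; 0; 1])];
    [:: (4, [:: 1; 1]); (1, [:: 1; 2; 0; 0; 0; 2; 0; 2; 1])];
    [:: (3, [:: 1; 1]); (2, [:: 2; 1]); (1, [:: 1; 2; 1; 0; 2; 1; 2; 1])];
    [:: (5, [:: 1; 1]); (1, [:: 1; 1; 1; 0; 1; 1; 1; 1])];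
    [:: (2, [:: 1; 0; 1; 1]); (1, [:: 1; 0; 0; 2; 2; 1; 1])];
    [:: (4, [:: 1; 1]); (2, [:: 2; 1]); (1, [:: 1; 1; 0; 1; 0; 1; 1])];
    [:: (3, [:: 1; 0; 1]); (1, [:: 1; 0; 2; 1; 2; 0; 1])];
    [:: (6, [:: 1; 1]); (1, [:: 1; 0; 1; 0; 1; 0; 1])];
    [:: (3, [:: 1; 1]); (2, [:: 1; 0; 1]); (1, [:: 2; 0; 0; 2; 0; 1])];
    [:: (5, [:: 3; 1]); (2, [:: 7; 1]); (1, [:: 3; 8; 7; 3; 1; 1])];
    [:: (4, [:: 1; 1]); (3, [:: 2; 1]); (1, [:: 1; 2; 0; 2; 2; 1])];
    [:: (7, [:: 1; 1]); (1, [:: 3; 6; 0; 4; 2; 1])];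
    [:: (2, [:: 1; 0; 0; 0; 1]); (1, [:: 2; 0; 1; 0; 1])];
    [:: (4, [:: 1; 1]); (2, [:: 1; 0; 1]); (1, [:: 1; 2; 1; 2; 1])];
    [:: (3, [:: 1; 0; 1]); (2, [:: 1; 1]); (1, [:: 1; 1; 1; 1; 1])];
    [:: (6, [:: 1; 1]); (2, [:: 2; 1]); (1, [:: 1; 2; 1; 2; 1])];
    [:: (5, [:: 1; 1]); (3, [:: 2; 1]); (1, [:: 3; 3; 1; 1; 1])];
    [:: (4, [:: 1; 0; 1]); (1, [:: 1; 0; 0; 0; 1])];
    [:: (8, [:: 1; 1]); (1, [:: 1; 1; 1; 1; 1])];
    [:: (3, [:: 1; 1]); (2, [:: 1; 1; 2; 1]); (1, [:: 2; 2; 2; 1])];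
    [:: (5, [:: 1; 1]); (2, [:: 1; 3; 1]); (1, [:: 3; 5; 4; 1])];
    [:: (4, [:: 1; 1]); (3, [:: 2; 1]); (2, [:: 3; 1]); (1, [:: 2; 4; 5; 1])];
    [:: (7, [:: 1; 1]); (2, [:: 3; 1]); (1, [:: 6; 5; 5; 1])];
    [:: (5, [:: 1; 1]); (4, [:: 3; 1]); (1, [:: 5; 1; 7; 1])];
    [:: (2, [:: 1; 0; 0; 0; 0; 1]); (1, [:: 1; 0; 1])];
    [:: (4, [:: 1; 1]); (2, [:: 2; 1; 3; 1]); (1, [:: 5; 5; 1])];
    [:: (3, [:: 2; 1; 1]); (2, [:: 1; 0; 1]); (1, [:: 2; 0; 1])];
    [:: (6, [:: 1; 1]); (2, [:: 1; 0; 1]); (1, [:: 3; 0; 1])];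
    [:: (5, [:: 1; 1]); (3, [:: 3; 1]); (2, [:: 2; 1]); (1, [:: 4; 0; 1])];
    [:: (4, [:: 1; 3; 1]); (2, [:: 1; 1]); (1, [:: 1; 7; 1])];
    [:: (8, [:: 1; 1]); (2, [:: 2; 1]); (1, [:: 1; 0; 1])];
    [:: (5, [:: 1; 0; 1]); (1, [:: 3; 0; 1])];
    [:: (3, [:: 1; 1]); (2, [:: 2; 1; 1; 2; 1]); (1, [:: 2; 1])];
    [:: (4, [:: 1; 1]); (3, [:: 3; 1]); (2, [:: 3; 0; 1]); (1, [:: 2; 1])];
    [:: (2, [:: 1; 0; 1; 0; 1; 0; 1])];
    [:: (4, [:: 1; 1]); (2, [:: 1; 1; 1; 1; 1])];
    [:: (4, [:: 1; 0; 1]); (2, [:: 2; 0; 1])]]%N.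

Definition factored_discriminant (fs : seq (nat * seq nat)) : seq nat :=
  prodp [seq prodp (nseq f.1 f.2) | f <- fs].

(** The last condition says that the product of the factors [f] is separable, so
    that a factor of degree [e] and multiplicity [n] contributes [n^e] to the
    partition. *)
Definition certified (fs : seq (nat * seq nat)) : bool :=
  let D := factored_discriminant fs in
  let F := prodp [seq f.2 | f <- fs] in
  let d i := nth 0%N D i in
  [&& all (fun f => (last 0 f.2 == 1) && (0 < f.1)) fs,
      sumn [seq f.1 * (size f.2).-1 | f <- fs] == 12,
      [&& d 1 == 0, d 11 == 0, unit9 (d 0) & unit9 (d 2)],
      cube9 (d 2) == mul9 (cube9 (d 10)) (mul9 (d 0) (d 0))
    & no_common_root 30 F (derivp F)]%N.

Lemma factorizations_certified : all certified factorizations.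
Proof. by vm_compute. Qed.

Lemma factorizations_complete :
  multiplicative_configurations =
  [seq tally_seq [seq (f.1, (size f.2).-1) | f <- fs] | fs <- factorizations].
Proof. by vm_compute. Qed.

Section NineValues.
Variables (k : closedFieldType) (char_k : 3%N \in [pchar k]).
Variables (i : k) (sqr_i : i ^+ 2 = -1).

Definition val9 n : k := (n %% 3)%:R + (n %/ 3)%:R * i.

Lemma modn3_natr n : (n %% 3)%:R = n%:R :> k.
Proof.
by rewrite [in RHS](divn_eq n 3) natrD natrM three_eq0 // mulr0 add0r.
Qed.

Lemma val9_pair m n : val9 (m %% 3 + 3 * (n %% 3)) = m%:R + n%:R * i.
Proof.
rewrite /val9; have -> : ((m %% 3 + 3 * (n %% 3)) %% 3 = m %% 3)%N by lia.
have -> : ((m %% 3 + 3 * (n %% 3)) %/ 3 = n %% 3)%N by lia.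
by rewrite !modn3_natr.
Qed.

Lemma val9D m n : val9 (add9 m n) = val9 m + val9 n.
Proof. by rewrite /add9 val9_pair !natrD /val9; ring. Qed.

Lemma val9M m n : val9 (mul9 m n) = val9 m * val9 n.
Proof.
rewrite /mul9 val9_pair !(natrD, natrM) two_eqN1 // /val9.
by rewrite -sqr_i; ring.
Qed.

Lemma val9_0 : val9 0 = 0.
Proof. by rewrite /val9 mul0r addr0. Qed.

Lemma val9_1 : val9 1 = 1.
Proof. by rewrite /val9 mul0r addr0. Qed.

Lemma val9_unit n : unit9 n -> val9 n != 0.
Proof.
case/hasP=> m _ /eqP eq1; apply: contra_neq (oner_neq0 k) => n0.
by rewrite -val9_1 -eq1 val9M n0 mulr0.
Qed.

Definition valp (s : seq nat) : {poly k} :=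
  foldr (fun n p => (val9 n)%:P + 'X * p) 0 s.

Lemma coef_valp s j : (valp s)`_j = val9 (nth 0%N s j).
Proof.
elim: s j => [|n s IHs] j /=; first by rewrite coef0 nth_nil val9_0.
by rewrite coefD coefC coefXM; case: j => [|j] /=; rewrite ?addr0 ?add0r.
Qed.

Lemma valpD s t : valp (addp s t) = valp s + valp t.
Proof.
elim: s t => [|m s IHs] [|n t] /=; rewrite ?add0r ?addr0 //.
by rewrite IHs val9D polyCD; ring.
Qed.

Lemma valpZ m s : valp (scalep m s) = (val9 m)%:P * valp s.
Proof.
elim: s => [|n s IHs] /=; first by rewrite mulr0.
by rewrite IHs val9M polyCM; ring.
Qed.

Lemma valpM s t : valp (mulp s t) = valp s * valp t.
Proof.
elim: s => [|m s IHs] /=; first by rewrite mul0r.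
by rewrite valpD valpZ /= IHs val9_0; ring.
Qed.

Lemma valp_prod ss : valp (prodp ss) = \prod_(s <- ss) valp s.
Proof.
elim: ss => [|s ss IHss]; first by rewrite big_nil /= val9_1 mulr0 addr0.
by rewrite big_cons /= valpM IHss.
Qed.

Lemma valp_deriv s : valp (derivp s) = (valp s)^`().
Proof.
elim: s => [|n s IHs] /=; first by rewrite deriv0.
by rewrite valpD /= IHs val9_0 derivD derivC derivM derivX; ring.
Qed.

Lemma valp_monic s : last 0%N s == 1%N ->
  valp s \is monic /\ size (valp s) = size s.
Proof.
case/lastP: s => [|s n] //; rewrite last_rcons => /eqP->.
have top : (valp (rcons s 1%N))`_(size s) = 1.
  by rewrite coef_valp nth_rcons ltnn eqxx val9_1.
have sz : size (valp (rcons s 1%N)) = (size s).+1.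
  apply/eqP; rewrite eqn_leq; apply/andP; split.
    apply/leq_sizeP=> j le_sj; rewrite coef_valp nth_default ?val9_0 //.
    by rewrite size_rcons.
  rewrite ltnNge; apply/negP => /leq_sizeP/(_ _ (leqnn _)).
  by rewrite top => /eqP; rewrite oner_eq0.
by rewrite size_rcons sz monicE /lead_coef sz top.
Qed.

Lemma no_common_rootP fuel s t a :
    a != 0 -> root (valp s) a -> root (valp t) a ->
  no_common_root fuel s t = false.
Proof.
move=> nz_a; elim: fuel s t => [|fuel IHf] [|m s] [|n t] //= root_s root_t.
have rootX (r : {poly k}) : root ('X * r) a -> root r a.
  by rewrite rootM rootX (negPf nz_a).
have root_tail l r : val9 l = 0 -> root ((val9 l)%:P + 'X * r) a -> root r a.
  by move=> ->; rewrite add0r; apply: rootX.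
case: eqP => [m0|_].
  by apply: IHf => //; apply: root_tail root_s; rewrite m0 val9_0.
case: eqP => [n0|_].
  by apply: IHf => //; apply: root_tail root_t; rewrite n0 val9_0.
case: nilP => [s0|_].
  apply: contraTF root_s => unit_m.
  by rewrite s0 /= mulr0 addr0 rootC val9_unit.
case: nilP => [t0|_].
  apply: contraTF root_t => unit_n.
  by rewrite t0 /= mulr0 addr0 rootC val9_unit.
have root_u : root (valp (addp (scalep n s) (scalep (mul9 2 m) t))) a.
  apply: rootX; rewrite valpD !valpZ val9M.
  have -> : val9 2 = -1 by rewrite -two_eqN1 // /val9 mul0r addr0.
  have -> : 'X * ((val9 n)%:P * valp s + (- 1 * val9 m)%:P * valp t) =
      (val9 n)%:P * ((val9 m)%:P + 'X * valp s)
      - (val9 m)%:P * ((val9 n)%:P + 'X * valp t).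
    by rewrite mulN1r polyCN; ring.
  rewrite /root hornerD hornerN !hornerM.
  by rewrite (rootP root_s) (rootP root_t) !mulr0 subrr.
by case: ifP => _; apply: IHf.
Qed.

Definition roots (s : seq nat) : seq k := projT1 (closed_field_poly_normal (valp s)).

Lemma valp_roots s : last 0%N s == 1%N ->
  valp s = \prod_(a <- roots s) ('X - a%:P) /\ size (roots s) = (size s).-1.
Proof.
move=> /valp_monic[/monicP lead1 sz_s].
rewrite /roots; case: closed_field_poly_normal => r /=; rewrite lead1 scale1r => Er.
by split=> //; rewrite -sz_s Er size_prod_XsubC.
Qed.

Lemma certified_surface fs : certified fs ->
  exists X : rational_elliptic_surface k,
    has_configuration X (tally_seq [seq (f.1, (size f.2).-1) | f <- fs]) /\
    b2_distinct_roots X.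
Proof.
case/and5P => [/allP fsP sum12 coefs eq_cubes noroot].
pose rs := [seq (a, f.1) | f <- fs, a <- roots f.2].
have fs1 f : f \in fs -> last 0%N f.2 == 1%N by case/fsP/andP.
have Ers : unzip2 rs = tally_seq [seq (f.1, (size f.2).-1) | f <- fs].
  rewrite /unzip2 /rs map_allpairs /tally_seq -map_comp; congr flatten.
  apply/eq_in_map => f f_fs /=; rewrite -(valp_roots (fs1 _ f_fs)).2.
  by elim: (roots f.2) => //= _ r ->.
have ED : valp (factored_discriminant fs) = mult_prod rs.
  rewrite /factored_discriminant valp_prod big_map /mult_prod /rs big_allpairs_dep.
  apply: eq_big_seq => f f_fs; rewrite valp_prod big_nseq iter_mulr_1 /=.
  by rewrite (valp_roots (fs1 _ f_fs)).1 prodrXl.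
have EF : valp (prodp [seq f.2 | f <- fs]) = \prod_(a <- unzip1 rs) ('X - a%:P).
  rewrite valp_prod big_map /unzip1 /rs map_allpairs big_allpairs_dep.
  by apply: eq_big_seq => f f_fs; rewrite (valp_roots (fs1 _ f_fs)).1.
have sum_rs : sumn (unzip2 rs) = 12%N.
  rewrite Ers /tally_seq sumn_flatten -!map_comp -(eqP sum12); congr sumn.
  by apply: eq_map => f /=; rewrite sumn_nseq.
have rs_gt0 : 0%N \notin unzip2 rs.
  rewrite Ers; apply/flattenP => -[_ /mapP[_ /mapP[f f_fs ->] ->]] /=.
  by rewrite mem_nseq => /andP[_ /eqP f0]; have /andP[_] := fsP _ f_fs; rewrite -f0.
have DE j : (mult_prod rs)`_j = val9 (nth 0%N (factored_discriminant fs) j).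
  by rewrite -ED coef_valp.
case/and4P: coefs => /eqP z1 /eqP z11 /val9_unit nz0 /val9_unit nz2.
have split_rs : two_root_discriminant (mult_prod rs).
  have D12 : (mult_prod rs)`_12 = 1.
    have /monicP := mult_prod_monic rs.
    by rewrite /lead_coef size_mult_prod sum_rs.
  split; rewrite ?D12 ?oner_neq0 // !DE //; first by rewrite z1 z11 val9_0.
  have cubeE n : val9 (cube9 n) = val9 n ^+ 3 by rewrite !val9M; ring.
  by rewrite expr1n mulr1 -cubeE (eqP eq_cubes) val9M cubeE val9M expr2.
rewrite -Ers; apply: (two_root_surface char_k _ rs_gt0 sum_rs split_rs).
rewrite -separable_prod_XsubC -EF unlock.
apply: Pdiv.ClosedField.root_coprimep => a root_a.
apply: contraTN noroot => root_a'; rewrite -valp_deriv in root_a'.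
have nz_a : a != 0.
  apply: contraNneq nz0 => a0; rewrite -DE -horner_coef0 -/(root _ _).
  by rewrite root_mult_prod // -root_prod_XsubC -EF -a0.
by rewrite (no_common_rootP _ nz_a root_a root_a').
Qed.
End NineValues.

(** * Partitions of twelve *)

(** The argument [fuel] bounds the number of parts and ensures termination. *)
Fixpoint bounded_partitions (fuel m n : nat) : seq (seq nat) :=
  if n == 0%N then [:: [::]] else
  if fuel is fuel'.+1 then
    [seq x :: s | x <- iota 1 (minn m n), s <- bounded_partitions fuel' x (n - x)%N]
  else [::].

Lemma mem_bounded_partitions fuel m n s : (n <= fuel)%N ->
  (s \in bounded_partitions fuel m n) =
  [&& path geq m s, 0%N \notin s & sumn s == n].
Proof.
elim: fuel m n s => [|fuel IHf] m [|n] s le_n //=.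
- by rewrite inE; case: s => [|[|x] s] //=; rewrite ?in_cons ?eqxx /= ?andbF.
- by rewrite inE; case: s => [|[|x] s] //=; rewrite ?in_cons ?eqxx /= ?andbF.
apply/allpairsPdep/idP => [[x [t [x_le t_in ->]]]|].
  move: x_le t_in; rewrite mem_iota => /andP[x_gt0 x_le].
  rewrite IHf; last by lia.
  case/and3P=> path_t t_gt0 /eqP sum_t /=; rewrite path_t inE negb_or t_gt0 sum_t.
  by move: x_gt0 x_le; lia.
case: s => [|x t] //= /and3P[/andP[le_xm path_t]].
rewrite inE negb_or => /andP[x_gt0 t_gt0] /eqP sum_t.
exists x, t; split=> //; first by rewrite mem_iota; move: x_gt0 le_xm sum_t; lia.
by rewrite IHf ?path_t ?t_gt0; move: x_gt0 sum_t; lia.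
Qed.

Definition partitions12 := bounded_partitions 12 12 12.

Lemma mem_partitions12 s : (s \in partitions12) = is_partition 12 s.
Proof.
rewrite mem_bounded_partitions // /is_partition.
apply/and3P/and3P => -[sort_s s_gt0 sum_s]; split=> //.
  exact: path_sorted sort_s.
case: s sort_s sum_s {s_gt0} => //= x s -> /eqP sum_s.
by rewrite andbT; move: sum_s; lia.
Qed.

Lemma partitions_with_many_parts_prime_to_3 s : is_partition 12 s ->
  (4 <= num_prime_to_3 s)%N ->
  s \in multiplicative_configurations ++
        [:: [:: 7; 2; 2; 1]; [:: 5; 4; 2; 1]; [:: 5; 2; 2; 2; 1]]%N.
Proof.
rewrite -mem_partitions12 => s_in; apply/implyP; move: s s_in; apply/allP.
by vm_compute.
Qed.

(** * The classification *)

Lemma perm_map_lift (S T : eqType) (f : S -> T) (s : seq S) (t : seq T) :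
  perm_eq (map f s) t -> exists2 s', perm_eq s s' & map f s' = t.
Proof.
case: s => [|x s] eq_t.
  by rewrite perm_sym in eq_t; exists [::]; rewrite ?(perm_nilP eq_t).
have /(perm_iotaP (f x)) [Is eq_Is ->] : perm_eq t (map f (x :: s)).
  by rewrite perm_sym.
exists [seq nth x (x :: s) i | i <- Is].
  rewrite perm_sym; apply/(perm_iotaP x); exists Is => //.
  by rewrite size_map in eq_Is.
rewrite -map_comp; apply/eq_in_map => i.
rewrite (perm_mem eq_Is) mem_iota size_map add0n => lt_i.
by rewrite (nth_map x).
Qed.

Section Necessity.
Variables (k : closedFieldType) (char_k : 3%N \in [pchar k]).

(** By counting the parts prime to 3, a partition outside the list would be one
    of the three exceptional ones, and the last of these when [b2] has a double
    root. In that case the point with a fibre of type I_5 is sent to 0. *)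
Lemma configuration_multiplicative (X : rational_elliptic_surface k) s :
    is_partition 12 s -> has_configuration X s ->
  s \in multiplicative_configurations.
Proof.
move=> part_s conf_s; have sum_s : sumn s = 12%N by case/and3P: part_s => _ _ /eqP.
have many := partitions_with_many_parts_prime_to_3 part_s.
have [[rs [uniq_rs s_rs split_rs]]|nonsplit] :=
    configuration_normal_form char_k part_s conf_s.
  have sum_rs : sumn (unzip2 rs) = 12%N by rewrite -(perm_sumn s_rs).
  have := two_root_discriminant_radical char_k sum_rs split_rs.
  rewrite /num_prime_to_3 -(permP s_rs) => /many; rewrite mem_cat => /orP[//|].
  rewrite perm_sym in s_rs; have [rs' rs_rs' Es] := perm_map_lift s_rs.
  have uniq_rs' : uniq (unzip1 rs') by rewrite -(perm_uniq (perm_map _ rs_rs')).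
  have Ers : mult_prod rs = mult_prod rs' by apply: perm_big.
  have sum_rs' : sumn (unzip2 rs') = 12%N by rewrite /unzip2 Es.
  rewrite Ers in split_rs.
  have := two_root_discriminant_power_sums char_k sum_rs' split_rs.
  rewrite -Es !inE => sums /or3P[] /eqP E; exfalso; move: uniq_rs' sums.
  - case: rs' E {rs_rs' Es Ers sum_rs' split_rs} =>
      [|[a ?] [|[b ?] [|[c ?] [|[d ?] []]]]] //.
    by case=> -> -> -> ->; exact: no_two_root_7221.
  - case: rs' E {rs_rs' Es Ers sum_rs' split_rs} =>
      [|[a ?] [|[b ?] [|[c ?] [|[d ?] []]]]] //.
    by case=> -> -> -> ->; exact: no_two_root_5421.
  - case: rs' E {rs_rs' Es Ers sum_rs' split_rs} =>
      [|[a ?] [|[b ?] [|[c ?] [|[d ?] [|[e ?] []]]]]] //.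
    by case=> -> -> -> -> -> _; exact: no_two_root_52221.
have [n0 n0_s] : exists n, n \in s.
  by case: s sum_s {part_s conf_s many nonsplit} => // n s _; exists n; exact: mem_head.
have count_s : (5 <= num_prime_to_3 s)%N.
  have [rs [_ s_rs ns_rs]] := nonsplit _ n0_s.
  have sum_rs : sumn (unzip2 rs) = 12%N by rewrite -(perm_sumn s_rs).
  have := double_root_discriminant_radical char_k sum_rs ns_rs.
  by rewrite /num_prime_to_3 -(permP s_rs).
have := many (ltnW count_s); rewrite mem_cat => /orP[//|].
rewrite !inE => /or3P[] /eqP Es; move: count_s; rewrite Es // => _; exfalso.
have [|rs [zero_rs s_rs ns_rs]] := nonsplit 5%N; first by rewrite Es.
rewrite perm_sym in s_rs; have [rs' rs_rs' Es'] := perm_map_lift s_rs.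
rewrite (perm_mem rs_rs') in zero_rs.
have Ers : mult_prod rs = mult_prod rs' by apply: perm_big.
rewrite {}Ers Es in ns_rs Es'; move: zero_rs ns_rs.
case: rs' Es' {rs_rs'} => [|[a ?] [|[b ?] [|[c ?] [|[d ?] [|[e ?] []]]]]] //.
case=> -> -> -> -> ->; rewrite !inE !xpair_eqE /= !andbF !orbF andbT => /eqP <-.
exact: no_double_root_52221.
Qed.
End Necessity.

Theorem mainTheorem2 (k : closedFieldType) (char_k : 3%N \in [pchar k]) :
  [/\ [/\ uniq multiplicative_configurations,
          size multiplicative_configurations = 40%N
        & all (is_partition 12) multiplicative_configurations],
      forall s : seq nat, is_partition 12 s ->
        ((exists X : rational_elliptic_surface k, has_configuration X s) <->
         s \in multiplicative_configurations),
      exists rest : seq (seq nat),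
        [/\ uniq rest,
            size rest = 37%N,
            forall s : seq nat,
              (s \in rest) =
              is_partition 12 s && (s \notin multiplicative_configurations)
          & forall s : seq nat, s \in rest ->
              ~ exists X : rational_elliptic_surface k, has_configuration X s]
    & forall s : seq nat, s \in multiplicative_configurations ->
        exists X : rational_elliptic_surface k,
          has_configuration X s /\ b2_distinct_roots X].
Proof.
have realized s : s \in multiplicative_configurations ->
    exists X : rational_elliptic_surface k,
      has_configuration X s /\ b2_distinct_roots X.
  rewrite factorizations_complete => /mapP[fs fs_in ->].
  have [i sqr_i] := has_nth_root (-1 : k) (isT : (0 < 2)%N).
  by apply: (certified_surface char_k sqr_i); apply: (allP factorizations_certified).
have excluded s : is_partition 12 s ->
    s \notin multiplicative_configurations ->
    ~ exists X : rational_elliptic_surface k, has_configuration X s.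
  move=> part_s s_notin [X conf_s]; case/negP: s_notin.
  exact: configuration_multiplicative conf_s.
split.
- by split; vm_compute.
- move=> s part_s; split=> [[X conf_s]|/realized[X [conf_s _]]]; last by exists X.
  exact: configuration_multiplicative conf_s.
- pose rest := [seq s <- partitions12 | s \notin multiplicative_configurations].
  have restE s : (s \in rest) =
      is_partition 12 s && (s \notin multiplicative_configurations).
    by rewrite mem_filter mem_partitions12 andbC.
  exists rest; split; [by vm_compute | by vm_compute | exact: restE |].
  by move=> s; rewrite restE => /andP[]; exact: excluded.
- exact: realized.
Qed.
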